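(* Let $G=(V,E)$ be a minimally $(r,Q)$-connected graph with $R,Q\subseteq V$, $Q\cup R=V$, and $r_{uv}\in\{0,1,2\}$ for all $u,v\in R$. Then every $R$-component of $G$ is a tree. Furthermore, for any subset $\mathcal{C}$ of connected components of $G\setminus R$, replacing, for each $C\in\mathcal{C}$, the corresponding tree (the $R$-component of $C$) by a DFS cycle on $\Gamma_G(C)$ of capacity $1/2$ results in a fractionally $(r,Q)$-connected graph.
   Context: $\lambda^Q_G(u,v)$ is the maximum number of $uv$-paths pairwise disjoint in edges and in nodes of $Q\setminus\{u,v\}$; $G$ is $(r,Q)$-connected if $\lambda^Q_G(u,v)\ge r_{uv}$ for all $u,v\in R$ with $r_{uv}>0$, and minimally so if no proper subgraph of $G$ is $(r,Q)$-connected. For $C\subseteq V$, $\Gamma_G(C)$ is the set of neighbors of $C$ outside $C$, $\delta_G(C)$ the edges with exactly one endnode in $C$, $E(C)$ the edges with both endnodes in $C$. For a connected component $C$ of $G\setminus R$, its $R$-component is the subgraph with node set $C\cup\Gamma_G(C)$ and edge set $E(C)\cup\delta_G(C)$. For a tree $T$ with leaf set $L$, a DFS cycle on $L$ is the cycle on $L$ visiting the leaves in the order in which a depth-first traversal of $T$ visits them. A biset is $\hat Y=(Y,Y^+)$ with $Y\subseteq Y^+\subseteq V$, $\Gamma(\hat Y)=Y^+\setminus Y$; an edge covers $\hat Y$ if one endnode is in $Y$ and the other in $V\setminus Y^+$. Let $f(\hat Y)=\max\{r_{uv}: uv$ covers $\hat Y, r_{uv}>0\}-|\Gamma(\hat Y)|$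 if $\Gamma(\hat Y)\subseteq Q$, and $0$ otherwise. A graph with edge capacities $x_e\in[0,1]$ (original edges having capacity $1$) is fractionally $(r,Q)$-connected if for every biset $\hat Y$ the total capacity of edges covering $\hat Y$ is at least $f(\hat Y)$. *)

(* Defs.v *)
From HB Require Import structures.
From mathcomp Require Import all_boot all_order all_algebra.

Set Implicit Arguments.
Unset Strict Implicit.
Unset Printing Implicit Defensive.

Import Order.TTheory GRing.Theory Num.Theory.

(* Loopless finite multigraphs.  Nodes and edges are drawn from finite ambient
   types T and E, and an ambient incidence function [ends : E -> {set T}] gives
   the endnodes of each edge; a graph is a node set together with an edge set,
   so that a subgraph is again a graph for the same [ends]. *)
Record graph (T E : finType) := Graph { nodes : {set T}; edges : {set E} }.

Section Graphs.

Variables (T E : finType) (ends : E -> {set T}).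
Implicit Types (G H : graph T E) (C R Q : {set T}) (r : T -> T -> nat).

Definition well_formed G : bool :=
  [forall e in edges G, (#|ends e| == 2) && (ends e \subset nodes G)].

Definition adj G : rel T :=
  fun x y => [exists e in edges G, ends e == [set x; y]].

(* A walk from x is the list of its successive (edge, next node) steps. *)
Fixpoint walk G (x : T) (p : seq (E * T)) : bool :=
  if p is (e, y) :: p' then
    [&& e \in edges G, ends e == [set x; y] & walk G y p']
  else x \in nodes G.

Definition is_uvpath G (u v : T) (p : seq (E * T)) : bool :=
  [&& walk G u p, last u (unzip2 p) == v & uniq (u :: unzip2 p)].

(* Two parallel edges form a cycle of length 2. *)
Definition is_cycle G (x : T) (p : seq (E * T)) : bool :=
  [&& p != [::], walk G x p, last x (unzip2 p) == x,
      uniq (unzip1 p) & uniq (unzip2 p)].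

Definition connected G : Prop :=
  nodes G != set0 /\ {in nodes G &, forall x y, connect (adj G) x y}.

Definition is_tree G : Prop :=
  connected G /\ forall x p, ~~ is_cycle G x p.

(* Disjointness of two uv-paths in edges and in nodes of Q \ {u, v}. *)
Definition Qdisjoint Q (u v : T) (p q : seq (E * T)) : bool :=
  ~~ has (mem (unzip1 p)) (unzip1 q) &&
  ~~ has [pred x in unzip2 p | x \in Q :\: [set u; v]] (unzip2 q).

(* A path has at most #|T| nodes, so bounded sequences contain all paths. *)
Definition Qlambda Q G (u v : T) : nat :=
  \max_(P : {set {bseq #|T| of E * T}} |
          [forall p in P, is_uvpath G u v (p : {bseq #|T| of E * T})] &&
          [forall p in P, forall q in P, (p != q) ==> Qdisjoint Q u v p q])
     #|P|.

Definition rQ_connected r R Q G : Prop :=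
  forall u v, u \in R -> v \in R -> u != v -> r u v > 0 ->
    r u v <= Qlambda Q G u v.

Definition proper_subgraph H G : Prop :=
  [/\ well_formed H, nodes H \subset nodes G, edges H \subset edges G
    & H <> G].

Definition minimally_rQ_connected r R Q G : Prop :=
  rQ_connected r R Q G /\
  forall H, proper_subgraph H G -> ~ rQ_connected r R Q H.

Definition graphD G R : graph T E :=
  Graph (nodes G :\: R) [set e in edges G | [disjoint ends e & R]].

Definition components G : {set {set T}} :=
  [set [set y in nodes G | connect (adj G) x y] | x in nodes G].

Definition neighbors G C : {set T} :=
  [set y in nodes G :\: C | [exists x in C, adj G x y]].

Definition cut_edges G C : {set E} :=
  [set e in edges G | #|ends e :&: C| == 1].

Definition inner_edges G C : {set E} :=
  [set e in edges G | ends e \subset C].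

Definition Rcomponent G C : graph T E :=
  Graph (C :|: neighbors G C) (inner_edges G C :|: cut_edges G C).

(* [s] lists L in the order in which a depth-first traversal of the tree G
   visits it (L is meant to be the leaf set of G; in a minimally connected
   graph the leaf set of an R-component is [neighbors G C]); the cycle on L
   then joins each x to [next s x].  The traversal
   starts at any node [root] and explores neighbors in the order given by any
   adjacency lists [g]; [dfs] returns the visited nodes last-visited first. *)
Definition dfs_cycle G (L : {set T}) (s : seq T) : Prop :=
  exists (g : T -> seq T) (root : T),
    [/\ forall x y, (y \in g x) = adj G x y,
        root \in nodes G
      & s = [seq x <- rev (dfs g #|T| [::] root) | x \in L]].

End Graphs.

Section Bisets.

Variables (T : finType).
Implicit Types (W Y Yp R Q : {set T}) (r : T -> T -> nat).

(* W is the node set of the graph, and S the set of endnodes of an edge. *)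
Definition covers W Y Yp (S : {set T}) : bool :=
  [exists x in Y, exists y in W :\: Yp, S == [set x; y]].

(* With the convention that the maximum of the empty set is 0, an uncovered
   biset has a requirement of at most 0, i.e. imposes no constraint. *)
Definition biset_max r R W Y Yp : nat :=
  \max_(uv : T * T | [&& uv.1 \in R, uv.2 \in R,
                         covers W Y Yp [set uv.1; uv.2]
                       & 0 < r uv.1 uv.2]) r uv.1 uv.2.

Definition biset_req r R Q W Y Yp : rat :=
  if Yp :\: Y \subset Q then
    ((biset_max r R W Y Yp)%:R - #|Yp :\: Y|%:R)%R
  else 0%R.

Definition frac_rQ_connected (E : finType) (ends : E -> {set T})
    (x : E -> rat) r R Q (G : graph T E) : Prop :=
  (forall e, e \in edges G -> (0 <= x e <= 1)%R) /\
  forall Y Yp, Y \subset Yp -> Yp \subset nodes G ->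
    (biset_req r R Q (nodes G) Y Yp <=
     \sum_(e in edges G | covers (nodes G) Y Yp (ends e)) x e)%R.

End Bisets.

(* Replacing, for each C in CC, the R-component of C by the cycle that visits
   [neighbors G C] in the cyclic order [s C].  The edges of the new graph are
   the remaining edges [inl e] and, for each C in CC and x in [neighbors G C],
   the edge [inr (C, x)] joining x to its successor; thus a cycle on two nodes
   consists of two parallel edges.  The nodes of C disappear. *)
Section Replace.

Variables (T E : finType) (ends : E -> {set T}) (G : graph T E).
Variables (CC : {set {set T}}) (s : {set T} -> seq T).

Definition repl_edge : finType := (E + {set T} * T)%type.

Definition repl_ends (e : repl_edge) : {set T} :=
  match e with
  | inl e0 => ends e0
  | inr (C, x) => [set x; next (s C) x]
  end.

Definition repl_cap (e : repl_edge) : rat :=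
  match e with
  | inl _ => 1%R
  | inr _ => (1 / 2%:R)%R
  end.

Definition repl_graph : graph T repl_edge :=
  Graph (nodes G :\: cover CC)
    [set e : repl_edge |
      match e with
      | inl e0 => (e0 \in edges G) &&
          [forall C in CC, e0 \notin edges (Rcomponent ends G C)]
      | inr (C, x) => (C \in CC) && (x \in neighbors ends G C)
      end].

End Replace.

(* Main.v *)
Require Import Defs.
From HB Require Import structures.
From mathcomp Require Import all_boot all_order all_algebra zify.

Set Implicit Arguments.
Unset Strict Implicit.
Unset Printing Implicit Defensive.

Import Order.TTheory GRing.Theory Num.Theory.

(* In a minimal G every edge e lies in a tight cut: for some pair u, v with
   r u v = 2, all other edges of the cut are met by a single "breaker", which is
   an edge or a node of Q (or e is a bridge).  The key fact is that G has no
   chord through Q \ R: a path W with inner nodes in Q \ R whose ends coincide, or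
   are still joined by two disjoint paths off W.  Indeed the breaker of an edge
   of such a W must lie on W, so it may be taken to be a node, and together with
   the edge it cuts off a segment of W; uncrossing a shortest segment with the
   tight cut of its next edge gives a shorter one, or a node of Q separating a
   pair with r u v = 2.
   A cycle of an R-component yields a closed chord, so R-components are trees.
   Two disjoint uv-paths cannot both meet the same component C, since a shortest
   connection inside C would be a chord; nor can one of them pass through
   Gamma(C) at z in Q while the other meets C.  So the two paths cross a biset at
   different edges or cycles, and each cycle crossed has capacity at least 1, or
   1/2 if its nodes include the node of Gamma(Y).  The order in which a cycle
   visits Gamma(C) is irrelevant for this. *)

(** * Two disjoint paths in a digraph *)

Section Reach.

Variable X : finType.
Implicit Types (e : rel X) (U A B : {set X}).

(** A path is represented by a vertex set [U] that contains it, so that disjointness of paths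
    becomes disjointness of sets. *)
Inductive reach e U B : X -> Prop :=
| reach0 a : a \in U -> a \in B -> reach e U B a
| reachS a b : a \in U -> e a b -> reach e U B b -> reach e U B a.

Definition reachb e U B a :=
  (a \in U) &&
  [exists b in B :&: U, connect [rel x y | [&& x \in U, y \in U & e x y]] a b].

Lemma reach_in e U B a : reach e U B a -> a \in U.
Proof. by case. Qed.

Lemma reachP e U B a : reflect (reach e U B a) (reachb e U B a).
Proof.
apply: (iffP andP) => [[aU /existsP[b /andP[]]]|].
  rewrite inE => /andP[bB _] /connectP[p pp lb]; rewrite {}lb in bB.
  elim: p a aU pp bB => [|c p IH] a aU /=; first by move=> _; apply: reach0.
  by case/andP=> /and3P[_ cU eac] pp lp; apply: reachS eac _ => //; apply: IH.
elim=> {}a => [aU aB|b aU eab _ [bU /existsP[c /andP[cB bc]]]]; split=> //.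
  by apply/existsP; exists a; rewrite inE aU aB connect0.
apply/existsP; exists c; rewrite cB /=; apply: connect_trans bc.
by apply: connect1; rewrite /= aU bU.
Qed.

Lemma reach_mono e e' U U' B a : subrel e e' -> U \subset U' ->
  reach e U B a -> reach e' U' B a.
Proof.
move=> see' /subsetP sU; elim=> {}a => [aU aB|b aU eab _ IH].
  by apply: reach0 => //; apply: sU.
by apply: reachS IH; [apply: sU | apply: see'].
Qed.

Lemma reach_cat e U U' B D a : reach e U D a ->
  (forall d, d \in D -> d \in U -> reach e (U :|: U') B d) ->
  reach e (U :|: U') B a.
Proof.
move=> ra rD; elim: ra => {}a => [aU aD|b aU eab _ IH]; first exact: rD.
by apply: reachS eab IH; rewrite inE aU.
Qed.

Lemma reach_target e U D a : reach e U D a ->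
  exists d, [/\ d \in D, d \in U & reach e U [set d] a].
Proof.
elim=> {}a => [aU aD|b aU eab _ [d [dD dU rb]]].
  by exists a; split=> //; apply: reach0; rewrite ?inE.
by exists d; split=> //; apply: reachS rb.
Qed.

Definition linked e U A B := exists2 a, a \in A & reach e U B a.

Lemma linked_mono e e' U U' A B : subrel e e' -> U \subset U' ->
  linked e U A B -> linked e' U' A B.
Proof. by move=> se sU [a aA ra]; exists a => //; apply: reach_mono ra. Qed.

Lemma reach_rev_cat e U A B x :
  reach (fun a b => e b a) U A x -> reach e U B x -> linked e U A B.
Proof.
elim=> {}x => [xU xA|y xU eyx ry IH] rx; first by exists x.
by apply: IH; apply: reachS eyx rx; apply: reach_in ry.
Qed.

(** The path is cut at its first vertex in [{s, x}]; up to there no arc leaves [x], so every arc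
    used survives in [e']. *)
Lemma reach_first_hit e e' U s x B a :
  (forall a b, e a b -> a != x -> e' a b) -> reach e U B a ->
  reach e' U [set s; x] a \/ reach e' (U :\ s) B a.
Proof.
move=> ee'; elim=> {}a => [aU aB|b aU eab _ IH].
  have [as_|nas] := boolP (a \in [set s; x]); [left | right]; first exact: reach0.
  by apply: reach0; move: nas; rewrite // !inE aU; case/norP=> ->.
have [as_|nas] := boolP (a \in [set s; x]); first by left; apply: reach0.
move: nas; rewrite !inE => /norP[nas nax].
case: IH => rb; [left | right]; apply: reachS (ee' _ _ eab nax) rb => //.
by rewrite !inE nas.
Qed.

(** The part of the path from its last visit to [s], or from [y] after its last use of the arc
    [(x, y)], avoids that arc. *)
Lemma reach_last_hit e e' U s x y B a :
  (forall a b, e a b -> (a, b) != (x, y) -> e' a b) -> s != x ->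
  reach e U B a ->
  linked e' U [set s; y] B \/ reach e' (U :\ s) B a.
Proof.
move=> ee' nsx; elim=> {}a => [aU aB|b aU eab _ [lb|rb]]; last 2 first.
- by left.
- have rb' : reach e' U B b by apply: reach_mono rb => //; apply: subsetDl.
  have [eab'|/ee' eab'] := eqVneq (a, b) (x, y).
    by left; exists b => //; case: eab' => _ ->; rewrite !inE eqxx orbT.
  have [as_|nas] := eqVneq a s.
    left; exists a; first by rewrite !inE as_ eqxx.
    by apply: reachS (eab' eab) rb'.
  by right; apply: reachS (eab' eab) rb; rewrite !inE nas.
have [as_|nas] := eqVneq a s.
  by left; exists a; rewrite ?inE ?as_ ?eqxx //; rewrite -as_; apply: reach0.
by right; apply: reach0; rewrite // !inE nas.
Qed.

(* Goering's induction: if deleting the arc (x, y) creates a separating vertex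
   s, then both {s, x} and {s, y} separate A from B, and systems of two disjoint
   paths from A to {s, x} and from {s, y} to B are glued at s and along the arc. *)
Theorem menger2 e A B (x0 : X) :
  (forall s, linked e [set~ s] A B) ->
  exists U1 U2, [/\ [disjoint U1 & U2], linked e U1 A B & linked e U2 A B].
Proof.
have [n] := ubnP #|[set p : X * X | e p.1 p.2]|.
elim: n e A B => // n IHn e A B le_n hyp.
have [[x y] exy|noe] := pickP [pred p : X * X | e p.1 p.2]; last first.
  (* Without arcs, a linked vertex lies in both [A] and [B]; removing the first such vertex and
     using the hypothesis again gives a second one. *)
  have e0 U a : reach e U B a -> a \in U :&: B.
    by case=> [{}a aU aB|{}a b _ eab]; [rewrite inE aU | case/idP: (noe (a, b))].
  have [a1 a1A /e0] := hyp x0; rewrite inE => /andP[_ a1B].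
  have [a2 a2A /e0] := hyp a1; rewrite !inE => /andP[na a2B].
  exists [set a1], [set a2]; split.
  - by rewrite disjoints1 inE eq_sym.
  - by exists a1 => //; apply: reach0; rewrite ?inE.
  - by exists a2 => //; apply: reach0; rewrite ?inE.
rewrite /= in exy; pose e' : rel X := [rel a b | e a b && ((a, b) != (x, y))].
have see' : subrel e' e by move=> a b /andP[].
have ee' a b : e a b -> (a, b) != (x, y) -> e' a b by move=> *; apply/andP.
have ee'x a b : e a b -> a != x -> e' a b.
  by move=> eab nax; apply: ee' => //; rewrite xpair_eqE negb_and nax.
have lt_n : #|[set p : X * X | e' p.1 p.2]| < n.
  rewrite -ltnS; apply: leq_trans le_n; rewrite ltnS; apply: proper_card.
  apply/properP; split; first by apply/subsetP=> p; rewrite !inE; apply: see'.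
  by exists (x, y); rewrite !inE //= /e' /= eqxx andbF.
have [/forallP all_s|] := boolP [forall s, [exists a in A, reachb e' [set~ s] B a]].
  have [s|U1 [U2 [dis l1 l2]]] := IHn e' A B lt_n.
    by have /existsP[a /andP[aA /reachP]] := all_s s; exists a.
  by exists U1, U2; split=> //; [apply: linked_mono l1 | apply: linked_mono l2].
rewrite negb_forall => /existsP[s nos].
have {}nos : ~ linked e' [set~ s] A B.
  move=> [a aA /reachP ra]; case/negP: nos.
  by apply/existsP; exists a; rewrite aA.
have nsx : s != x.
  apply/eqP=> sx; have [a aA ra] := hyp s; apply: nos; exists a => //.
  elim: ra => {aA}a => [aU aB|b aU eab _ IH]; first exact: reach0.
  by apply: reachS IH => //; apply: ee'x; rewrite // -sx; move: aU; rewrite !inE.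
have subC t : [set~ t] :\ s \subset [set~ s].
  by apply/subsetP=> b; rewrite !inE => /andP[].
have [t|U1 [U2 [disU [a1 a1A r1] [a2 a2A r2]]]] := IHn e' A [set s; x] lt_n.
  have [a aA /(reach_first_hit s ee'x)[]] := hyp t; first by exists a.
  by move=> ra; case: nos; exists a => //; apply: reach_mono ra.
have [t|V1 [V2 [disV [c1 c1s q1] [c2 c2s q2]]]] := IHn e' [set s; y] B lt_n.
  have [a aA /(reach_last_hit ee' nsx)[]] := hyp t => //.
  by move=> ra; case: nos; exists a => //; apply: reach_mono ra.
(* [Us] is the side of [A] and [Ws] the side of [B] with respect to the separating vertex [s].
   Trimmed to their sides, paths on different sides meet at most in [s]. *)
pose Us := s |: [set b | reachb (fun c d => e' d c) [set~ s] A b].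
pose Ws := s |: [set b | reachb e' [set~ s] B b].
have disUW b : b \in Us -> b \in Ws -> b = s.
  rewrite !inE => /predU1P[//|/reachP ra] /predU1P[//|/reachP rb].
  by case: nos; apply: reach_rev_cat ra rb.
have AUs a : a \in A -> a \in Us.
  move=> aA; rewrite !inE; have [//|nas] := eqVneq a s.
  by apply/reachP; apply: reach0; rewrite ?inE.
have cleanU (U D : {set X}) a : (s \in U -> s \in D) -> a \in Us -> reach e' U D a ->
    reach e' (U :&: Us) D a.
  move=> sUD + ra; elim: ra => {}a => [aU aD|b aU eab rb IH] aUs.
    by apply: reach0; rewrite // inE aU.
  have [as_|nas] := eqVneq a s.
    by apply: reach0; [rewrite inE aU | rewrite as_ sUD -?as_].
  apply: (reachS _ eab); first by rewrite inE aU.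
  apply: IH; move: aUs; rewrite !inE (negPf nas) /= => /reachP ra.
  have [//|nbs] := eqVneq b s.
  by apply/reachP; apply: (@reachS _ _ _ b a); rewrite ?inE.
(* If the path visits [s], only the part from its last visit on is kept. *)
have cleanW (V : {set X}) c : reach e' V B c ->
    (reach e' [set~ s] B c /\ reach e' (V :&: Ws) B c) \/
    (s \in V /\ reach e' (V :&: Ws) B s).
  elim=> {}c => [cV cB|d cV ecd _ [[rd rd']|]]; last by right.
    have [cs|ncs] := eqVneq c s; [right | left].
      by rewrite -cs; split=> //; apply: reach0; rewrite // !inE cV cs eqxx.
    have rc : reach e' [set~ s] B c by apply: reach0; rewrite ?inE.
    by split=> //; apply: reach0; rewrite // !inE cV; apply/orP; right; apply/reachP.
  have [cs|ncs] := eqVneq c s; [right | left].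
    rewrite -cs; split=> //; apply: reachS ecd rd'.
    by rewrite !inE cV cs eqxx.
  have rc : reach e' [set~ s] B c by apply: reachS ecd rd; rewrite !inE.
  split=> //; apply: reachS ecd rd'.
  by rewrite !inE cV; apply/orP; right; apply/reachP.
have glue (N1 N2 M1 M2 : {set X}) b1 b2 : [disjoint N1 & N2] -> [disjoint M1 & M2] ->
    b1 \in A -> b2 \in A -> s \in N1 -> s \in M1 ->
    reach e' N1 [set s] b1 -> reach e' N2 [set x] b2 ->
    reach e' M1 B s -> reach e' M2 B y ->
    exists U1 U2, [/\ [disjoint U1 & U2], linked e U1 A B & linked e U2 A B].
  move=> disN disM b1A b2A sN sM p1 p2 p3 p4.
  have sN2 : s \notin N2 by rewrite (disjointFr disN).
  have sM2 : s \notin M2 by rewrite (disjointFr disM).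
  have {}p1 : reach e' (N1 :&: Us) [set s] b1.
    by apply: cleanU; rewrite ?set11 ?AUs.
  have {}p2 : reach e' (N2 :&: Us) [set x] b2.
    by apply: cleanU; rewrite ?AUs // (negPf sN2).
  have {}p3 : reach e' (M1 :&: Ws) B s by case: (cleanW _ _ p3) => -[].
  have {}p4 : reach e' (M2 :&: Ws) B y.
    by case: (cleanW _ _ p4) => -[] //; rewrite (negPf sM2).
  exists ((N1 :&: Us) :|: (M1 :&: Ws)), ((N2 :&: Us) :|: (M2 :&: Ws)); split.
  - rewrite disjoints_subset; apply/subsetP=> b /setUP[]/setIP[bN bU];
      rewrite in_setC; apply/negP=> /setUP[]/setIP[bN' bU'].
    + by rewrite (disjointFr disN bN) in bN'.
    + by move: sM2; rewrite -(disUW _ bU bU') bN'.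
    + by move: sN2; rewrite -(disUW _ bU' bU) bN'.
    + by rewrite (disjointFr disM bN) in bN'.
  - exists b1 => //; apply: reach_cat (reach_mono see' (subxx _) p1) _ => d.
    by rewrite inE => /eqP-> _; apply: reach_mono p3 => //; apply: subsetUr.
  - exists b2 => //; apply: reach_cat (reach_mono see' (subxx _) p2) _ => d.
    rewrite inE => /eqP-> xN; apply: (reachS _ exy); first by rewrite inE xN.
    by apply: reach_mono p4 => //; apply: subsetUr.
have [d1 [d1s d1U {}r1]] := reach_target r1.
have [d2 [d2s d2U {}r2]] := reach_target r2.
have c1V := reach_in q1; have c2V := reach_in q2.
have nd : d1 != d2 by apply: contraTneq d1U => ->; rewrite (disjointFl disU).
have nc : c1 != c2 by apply: contraTneq c1V => ->; rewrite (disjointFl disV).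
have disU' : [disjoint U2 & U1] by rewrite disjoint_sym.
have disV' : [disjoint V2 & V1] by rewrite disjoint_sym.
move: nd nc d1s d2s c1s c2s; rewrite !inE => nd nc.
case/orP=> /eqP Ed1 /orP[]/eqP Ed2; rewrite Ed1 Ed2 ?eqxx // in nd r1 r2 d1U d2U;
case/orP=> /eqP Ec1 /orP[]/eqP Ec2; rewrite Ec1 Ec2 ?eqxx // in nc q1 q2 c1V c2V.
- exact: (glue U1 U2 V1 V2 a1 a2).
- exact: (glue U1 U2 V2 V1 a1 a2).
- exact: (glue U2 U1 V1 V2 a2 a1).
- exact: (glue U2 U1 V2 V1 a2 a1).
Qed.

End Reach.

(** * Cuts and disjoint paths *)

Section Cuts.

Variables (T E : finType) (ends : E -> {set T}).
Implicit Types (G H : graph T E) (Q S : {set T}) (u v x y : T) (e g : E).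

Lemma wf_ends G e : well_formed ends G -> e \in edges G ->
  exists x y, [/\ ends e = [set x; y], x != y, x \in nodes G & y \in nodes G].
Proof.
move=> /forallP/(_ e)/implyP wfG /wfG/andP[/cards2P[x [y [nxy exy]]]].
rewrite exy => /subsetP sG; exists x, y.
by split=> //; apply: sG; rewrite !inE eqxx ?orbT.
Qed.

Lemma wf_neq G e x y : well_formed ends G -> e \in edges G ->
  ends e = [set x; y] -> x != y.
Proof.
move=> wfG eG exy; have [a [b [eab nab _ _]]] := wf_ends wfG eG.
by apply: contraNneq nab => xy; have := cards2 a b; rewrite -eab exy xy setUid cards1; case: eqP.
Qed.

Lemma wf_nodes G e x : well_formed ends G -> e \in edges G -> x \in ends e ->
  x \in nodes G.
Proof. by move=> /forallP/(_ e)/implyP wfG /wfG/andP[_ /subsetP]; apply. Qed.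

Lemma in_cut_edges G S e x y : well_formed ends G -> e \in edges G ->
  ends e = [set x; y] -> (e \in cut_edges ends G S) = ((x \in S) != (y \in S)).
Proof.
move=> wfG eG exy; have nxy := wf_neq wfG eG exy; rewrite inE eG exy /=.
rewrite setIUl cardsU.
have I1 z : #|[set z] :&: S| = (z \in S).
  have [zS|zS] := boolP (z \in S); first by rewrite (setIidPl _) ?sub1set ?cards1.
  by apply/eqP; rewrite cards_eq0 setI_eq0 disjoints1.
rewrite !I1 (_ : _ :&: _ = set0) ?cards0 ?subn0; first by do 2!case: (_ \in _).
by apply/setP=> z; rewrite !inE; apply: contraNF nxy => /andP[/andP[/eqP<- _] /andP[]].
Qed.

Definition hit (b : E + T) (g : E) : bool :=
  match b with inl f => g == f | inr z => z \in ends g end.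

(** Two paths counted by [Qlambda] cannot share such an element, whereas nodes outside [Q] and the
    ends [u], [v] may be shared. *)
Definition breaker Q u v (b : E + T) : bool :=
  if b is inr z then z \in Q :\: [set u; v] else true.

(* By Menger's theorem this amounts to [1 < Qlambda Q G u v], for u != v. *)
Definition robust Q G u v : Prop :=
  forall S b, (u \in S) != (v \in S) -> breaker Q u v b ->
    exists2 g, g \in cut_edges ends G S & ~~ hit b g.

Definition delete_edge G e : graph T E := Graph (nodes G) (edges G :\ e).

Lemma wf_delete_edge G e : well_formed ends G -> well_formed ends (delete_edge G e).
Proof.
move=> /forallP wfG; apply/forallP=> f; apply/implyP; rewrite inE => /andP[_ fG].
exact: (implyP (wfG f)).
Qed.

Lemma cut_edgesC G S : well_formed ends G ->
  cut_edges ends G (~: S) = cut_edges ends G S.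
Proof.
move=> wfG; apply/setP=> e; have [eG|eG] := boolP (e \in edges G); last first.
  by rewrite !inE (negPf eG).
have [x [y [exy _ _ _]]] := wf_ends wfG eG.
by rewrite !(in_cut_edges _ wfG eG exy) !inE; do 2!case: (_ \in S).
Qed.

Lemma cut_delete_edge G S e :
  cut_edges ends (delete_edge G e) S = cut_edges ends G S :\ e.
Proof. by apply/setP=> f; rewrite !inE; case: (f == e). Qed.

Lemma walk_ends G x p e z : walk ends G x p -> e \in unzip1 p -> z \in ends e ->
  z \in x :: unzip2 p.
Proof.
elim: p x => //= -[f y] p IH x /= /and3P[_ /eqP fxy wp].
rewrite inE => /predU1P[->|ep].
  by rewrite fxy !inE => /orP[]->; rewrite ?orbT.
by move=> ze; rewrite inE (IH _ wp ep ze) orbT.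
Qed.

Lemma walk_cut G S x p : well_formed ends G -> walk ends G x p ->
  (x \in S) != (last x (unzip2 p) \in S) ->
  exists2 g, g \in unzip1 p & g \in cut_edges ends G S.
Proof.
move=> wfG; elim: p x => [x _|[f y] p IH x]; first by rewrite eqxx.
move=> /= /and3P[fG /eqP fxy wp] nS.
have [xy|xy] := eqVneq (x \in S) (y \in S).
  rewrite xy in nS; have [g gp gc] := IH _ wp nS.
  by exists g => //; rewrite inE gp orbT.
by exists f; rewrite ?mem_head // (in_cut_edges _ wfG fG fxy).
Qed.

Lemma walk_cat G x p q : walk ends G x (p ++ q) ->
  well_formed ends G -> walk ends G x p /\ walk ends G (last x (unzip2 p)) q.
Proof.
move=> + wfG; elim: p x => [|[f y] p IH] x /=.
  move=> wq; split=> //; case: q wq => [//|[f y] q] /= /and3P[fG /eqP fxy _].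
  by apply: (wf_nodes wfG fG); rewrite fxy !inE eqxx.
by case/and3P=> -> -> /IH[-> ->].
Qed.

Lemma bigmax_witness (I : finType) (P : pred I) (F : I -> nat) k :
  k < \max_(i | P i) F i -> exists2 i, P i & k < F i.
Proof.
move=> kF; have [/existsP[i /andP[]]|no] := boolP [exists i, P i && (k < F i)].
  by exists i.
suff : \max_(i | P i) F i <= k by rewrite leqNgt kF.
apply/bigmax_leqP=> i Pi; rewrite leqNgt; apply: contra no => ki.
by apply/existsP; exists i; rewrite Pi.
Qed.

Lemma Qlambda_path Q G u v : 0 < Qlambda ends Q G u v ->
  exists p, is_uvpath ends G u v p.
Proof.
case/bigmax_witness=> P /andP[/forallP path_P _] /card_gt0P[p pP].
by exists p; apply: (implyP (path_P p)).
Qed.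

Lemma Qlambda_paths Q G u v : 1 < Qlambda ends Q G u v ->
  exists p q, [/\ is_uvpath ends G u v p, is_uvpath ends G u v q
                & Qdisjoint Q u v p q].
Proof.
case/bigmax_witness=> P /andP[/forallP path_P /forallP dis_P].
case/card_gt1P=> p [q [pP qP npq]]; exists p, q.
split; [exact: (implyP (path_P p)) | exact: (implyP (path_P q))|].
by have /implyP/(_ pP)/forallP/(_ q)/implyP/(_ qP)/implyP := dis_P p; apply.
Qed.

Lemma path_bseq G u v p : is_uvpath ends G u v p ->
  exists p' : {bseq #|T| of E * T}, p = p'.
Proof.
case/and3P=> _ _ /card_uniqP up.
have sz : size p <= #|T|.
  by have := max_card [in u :: unzip2 p]; rewrite up /= size_map; apply: ltnW.
by exists (Bseq sz).
Qed.

Lemma path_Qlambda Q G u v p : is_uvpath ends G u v p -> 0 < Qlambda ends Q G u v.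
Proof.
move=> pP; have [p' Ep] := path_bseq pP; rewrite {p}Ep in pP.
apply: leq_trans (leq_bigmax_cond [set p'] _); first by rewrite cards1.
apply/andP; split; apply/forallP=> q; apply/implyP=> /set1P->//.
by apply/forallP=> q'; apply/implyP=> /set1P->; rewrite eqxx.
Qed.

Lemma Qdisjoint_sym Q u v (p q : seq (E * T)) :
  Qdisjoint Q u v p q = Qdisjoint Q u v q p.
Proof.
rewrite /Qdisjoint; congr (~~ _ && ~~ _); first by rewrite has_sym.
by apply/hasP/hasP=> -[x xp /andP[xq xQ]]; exists x => //; rewrite inE xp.
Qed.

Lemma paths_Qlambda Q G u v p q : u != v ->
  is_uvpath ends G u v p -> is_uvpath ends G u v q -> Qdisjoint Q u v p q ->
  1 < Qlambda ends Q G u v.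
Proof.
move=> nuv pP qP dpq; have [p' Ep] := path_bseq pP; have [q' Eq] := path_bseq qP.
rewrite {p}Ep in pP dpq; rewrite {q}Eq in qP dpq.
(* Since [u != v], the path is nonempty, and its first edge would be shared. *)
have npq : p' != q'.
  apply: contraTneq dpq => <-; rewrite /Qdisjoint negb_and !negbK.
  case/and3P: pP => _; case: (val p') => [/eqP|[f y] p /= _ _].
    by move/eqP; rewrite (negPf nuv).
  by rewrite mem_head.
apply: leq_trans (leq_bigmax_cond [set p'; q'] _); first by rewrite cards2 npq.
apply/andP; split; apply/forallP=> a; apply/implyP; first by case/set2P=> ->.
move=> aP; apply/forallP=> b; apply/implyP; move: aP.
by case/set2P=> -> /set2P[]->; rewrite ?eqxx //; apply/implyP=> _;
  rewrite ?dpq // Qdisjoint_sym.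
Qed.

(** Both paths cross [S], and a breaker hitting a crossing edge of each would be common to the two
    paths. *)
Lemma Qlambda_robust Q G u v : well_formed ends G ->
  1 < Qlambda ends Q G u v -> robust Q G u v.
Proof.
move=> wfG /Qlambda_paths[p [q [pP qP]]].
case/and3P: pP => pw /eqP pl up; case/and3P: qP => qw /eqP ql uq.
case/andP=> /hasPn dE /hasPn dQ S b nS bb.
have [|||gp gpp gpc] := @walk_cut G S u p; rewrite ?pl //.
have [|||gq gqq gqc] := @walk_cut G S u q; rewrite ?ql //.
have [hp|?] := boolP (hit b gp); last by exists gp.
have [hq|?] := boolP (hit b gq); last by exists gq.
case: b bb hp hq => [f _ /eqP<- /eqP Eq|z /= zQ zp zq].
  by have := dE _ gqq; rewrite Eq /= gpp.
have [nzu _] : z != u /\ z != v.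
  by move: zQ; rewrite !inE negb_or => /andP[/andP[]].
have := walk_ends pw gpp zp; have := walk_ends qw gqq zq.
rewrite !inE (negPf nzu) /= => /dQ /=.
by move=> + zp'; rewrite zp' zQ.
Qed.

Lemma Qlambda_linked Q G u v S : well_formed ends G ->
  0 < Qlambda ends Q G u v -> (u \in S) != (v \in S) ->
  exists g, g \in cut_edges ends G S.
Proof.
move=> wfG /Qlambda_path[p /and3P[pw /eqP pl _]] nS.
by have [|||g _ gc] := @walk_cut G S u p; rewrite ?pl //; exists g.
Qed.

End Cuts.

(** * Menger's theorem for edges and nodes of Q *)

Section MixedMenger.

Variables (T E : finType) (ends : E -> {set T}) (G : graph T E).
Variables (Q : {set T}) (u v : T).
Hypotheses (wfG : well_formed ends G) (uG : u \in nodes G) (nuv : u != v).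
Implicit Types (U : {set E + T}) (x y : T) (e f : E).

Local Notation Q' := (Q :\: [set u; v]).

(* Edges and nodes of Q \ {u, v} become vertices, so that vertex-disjoint paths
   of this relation are the disjoint paths counted by Qlambda; the remaining
   nodes may be shared and only make their incident edges adjacent. *)
Definition element_rel : rel (E + T) := fun a b =>
  match a, b with
  | inl f, inl g => [&& f \in edges G, g \in edges G &
                     [exists y, [&& y \in ends f, y \in ends g & y \notin Q']]]
  | inl f, inr q => [&& f \in edges G, q \in Q' & q \in ends f]
  | inr q, inl f => [&& f \in edges G, q \in Q' & q \in ends f]
  | inr _, inr _ => false
  end.

Definition edges_at x : {set E + T} :=
  [set a : E + T | if a is inl f then (f \in edges G) && (x \in ends f) else false].

(** Testing only the entered node is enough: the walks of interest start at [u], which is outside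
    [Q']. *)
Definition step U : rel T := fun x y =>
  [exists f in edges G, (inl f \in U) && (ends f == [set x; y])] &&
  ((y \in Q') ==> (inr y \in U)).

Lemma step_edge U f x y : f \in edges G -> inl f \in U -> x \in ends f ->
  y \in ends f -> (y \in Q' -> inr y \in U) -> connect (step U) x y.
Proof.
move=> fG fU xf yf yU; have [->|nxy] := eqVneq x y; first exact: connect0.
apply: connect1; apply/andP; split; last exact/implyP.
apply/existsP; exists f; rewrite fG fU /= eq_sym eqEcard subUset !sub1set xf yf.
have [a [b [-> nab _ _]]] := wf_ends wfG fG.
by rewrite !cards2 nab nxy.
Qed.

Lemma linked_of_step U : connect (step U) u v ->
  linked element_rel U (edges_at u) (edges_at v).
Proof.
have path_reach x p : path (step U) x p -> p != [::] -> last x p = v ->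
    exists f, [/\ f \in edges G, x \in ends f &
                reach element_rel U (edges_at v) (inl f)].
  elim: p x => // y p IH x /= /andP[/andP[xy yU] pp] _ lp.
  case/existsP: xy => f /and3P[fG fU /eqP fxy]; exists f.
  rewrite fxy !inE eqxx /=; split=> //; case: p => [|z p] in IH pp lp *.
    by apply: reach0; rewrite // inE fG fxy -lp !inE eqxx orbT.
  have [||g [gG yg rg]] := IH _ pp => //.
  have [yQ|yQ] := boolP (y \in Q').
    apply: (@reachS _ _ _ _ _ (inr y)) => //=.
      by rewrite fG yQ fxy !inE eqxx orbT.
    apply: (reachS _ _ rg); first exact: (implyP yU).
    by rewrite /= gG yQ yg.
  apply: (reachS fU _ rg); rewrite /= fG gG /=.
  by apply/existsP; exists y; rewrite yg yQ fxy !inE eqxx orbT.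
case/connectP=> p pp vl; have [||f [fG uf rf]] := path_reach u p pp => //.
  by apply: contraNneq nuv => p0; rewrite vl p0.
by exists (inl f); rewrite // inE fG.
Qed.

Lemma step_of_linked U :
  linked element_rel U (edges_at u) (edges_at v) -> connect (step U) u v.
Proof.
move=> [a]; rewrite inE; case: a => // f /andP[fG uf] rf.
(* The invariant translates elements back to nodes: an edge has an admissible endnode joined to [v],
   and a node is itself joined to [v]. *)
pose P (a : E + T) := match a with
  | inl f => f \in edges G -> exists y,
       [/\ y \in ends f, y \in Q' -> inr y \in U & connect (step U) y v]
  | inr q => connect (step U) q v
  end.
suff: P (inl f).
  case=> // y [yf yU yv]; apply: connect_trans yv.
  by apply: (step_edge fG) => //; apply: reach_in rf.
elim: rf => {f fG uf} [a _|a b aU].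
  by rewrite inE; case: a => // f /andP[fG vf] _; exists v; rewrite !inE eqxx orbT.
case: a aU => [f|q] aU; case: b => [g|q'] //=.
- case/and3P=> fG gG /existsP[y /and3P[yf yg yQ]] rg IH _.
  exists y; split=> //; first by rewrite (negPf yQ).
  have [z [zg zU zv]] := IH gG; apply: connect_trans zv.
  by apply: (step_edge gG) => //; apply: reach_in rg.
- by case/and3P=> fG qQ qf rq IH _; exists q'; split=> // _; apply: reach_in rq.
- case/and3P=> gG qQ qg rg /(_ gG)[z [zg zU zv]]; apply: connect_trans zv.
  by apply: (step_edge gG) => //; apply: reach_in rg.
Qed.

Lemma path_of_step U : connect (step U) u v ->
  exists p, [/\ is_uvpath ends G u v p, {in unzip1 p, forall f, inl f \in U}
              & {in unzip2 p, forall y, y \in Q' -> inr y \in U}].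
Proof.
have walk_of x p : x \in nodes G -> path (step U) x p ->
    exists q, [/\ walk ends G x q, unzip2 q = p,
      {in unzip1 q, forall f, inl f \in U}
    & {in unzip2 q, forall y, y \in Q' -> inr y \in U}].
  elim: p x => [|y p IH] x xG /=; first by move=> _; exists [::]; split.
  case/andP=> /andP[/existsP[f /and3P[fG fU /eqP fxy]] yU] pp.
  have yG : y \in nodes G by apply: (wf_nodes wfG fG); rewrite fxy !inE eqxx orbT.
  have [q [wq Eq qE qT]] := IH _ yG pp; exists ((f, y) :: q).
  split=> /=; rewrite ?fG ?fxy ?eqxx ?Eq //.
    by move=> g; rewrite inE => /predU1P[->|/qE].
  move=> z; rewrite inE => /predU1P[->|zp]; first exact: (implyP yU).
  by apply: qT; rewrite Eq.
case/connectP=> p0 /shortenP[p pp up _] vl {p0}.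
have [q [wq Eq qE qT]] := walk_of u p uG pp.
by exists q; split=> //; rewrite /is_uvpath wq Eq -vl eqxx up.
Qed.

(** If no single element separates [u] from [v], [menger2] gives the two paths. Otherwise [S]
    collects the nodes still reachable from [u], and only [b] can stop a walk from leaving [S]. The
    edge [e0] serves as an inhabitant for [menger2] and as a breaker of an empty cut. *)
Lemma Qlambda_or_cut (e0 : E) : 1 < Qlambda ends Q G u v \/
  exists (S : {set T}) (b : E + T), [/\ u \in S, v \notin S, breaker Q u v b
                & {in cut_edges ends G S, forall g, hit ends b g}].
Proof.
have [/forallP linked_all|] := boolP [forall b, connect (step [set~ b]) u v].
  left; have [b|U1 [U2 [dis l1 l2]]] := @menger2 _ element_rel (edges_at u)
    (edges_at v) (inl e0); first exact: linked_of_step (linked_all b).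
  have [p [pP pE pT]] := path_of_step (step_of_linked l1).
  have [q [qP qE qT]] := path_of_step (step_of_linked l2).
  apply: (paths_Qlambda nuv pP qP); apply/andP; split; apply/hasPn.
    by move=> f /qE fU; apply/negP=> /pE; rewrite (disjointFl dis).
  move=> y /qT yU; apply/negP=> /andP[/pT yU' yQ].
  by have := yU' yQ; rewrite (disjointFl dis (yU yQ)).
rewrite negb_forall => /existsP[b nb]; right.
pose S := [set x | connect (step [set~ b]) u x].
have cutS g : g \in cut_edges ends G S ->
    b = inl g \/ exists2 z, b = inr z & (z \in Q') && (z \in ends g).
  move=> gS; have gG : g \in edges G by move: gS; rewrite inE => /andP[].
  have [x [y [gxy _ _ _]]] := wf_ends wfG gG.
  have aux x' y' : ends g = [set x'; y'] -> x' \in S -> y' \notin S ->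
      b = inl g \/ exists2 z, b = inr z & (z \in Q') && (z \in ends g).
    rewrite !inE => gxy' ux uy.
    have [->|nbg] := eqVneq b (inl g); [by left | right].
    have [yb|nyb] := boolP ((y' \in Q') && (b == inr y')).
      by case/andP: yb => yQ /eqP->; exists y'; rewrite // yQ gxy' !inE eqxx orbT.
    case/negP: uy; apply: connect_trans ux _; apply: connect1; apply/andP; split.
      by apply/existsP; exists g; rewrite gG gxy' eqxx !inE eq_sym nbg.
    by apply/implyP=> yQ; rewrite !inE eq_sym; rewrite yQ in nyb.
  move: gS; rewrite (in_cut_edges _ wfG gG gxy).
  have [xS|xS] := boolP (x \in S); have [yS|yS] := boolP (y \in S) => // _.
    exact: (aux x y).
  by apply: (aux y x) => //; rewrite setUC.
exists S; have [bb|nbb] := boolP (breaker Q u v b).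
  exists b; split=> //; rewrite ?inE ?connect0 // => g /cutS[->|[z -> /andP[]]] //=.
exists (inl e0); split=> //; rewrite ?inE ?connect0 // => g /cutS[Eb|[z Eb]].
  by rewrite Eb in nbb.
by rewrite Eb /= in nbb; rewrite (negPf nbb).
Qed.

Lemma Qlambda0_cut : Qlambda ends Q G u v = 0 ->
  exists S : {set T}, [/\ u \in S, v \notin S & cut_edges ends G S = set0].
Proof.
move=> l0; exists [set x | connect (step setT) u x].
rewrite !inE connect0; split=> //.
  apply/negP=> /path_of_step[p [pP _ _]].
  by have := path_Qlambda Q pP; rewrite l0.
apply/setP=> g; rewrite [g \in set0]inE; apply/negP=> gS.
have gG : g \in edges G by move: gS; rewrite inE => /andP[].
have [x [y [gxy _ _ _]]] := wf_ends wfG gG; move: gS.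
rewrite (in_cut_edges _ wfG gG gxy) !inE => /negP; apply; apply/eqP.
have xg : x \in ends g by rewrite gxy !inE eqxx.
have yg : y \in ends g by rewrite gxy !inE eqxx orbT.
by apply/idP/idP=> /connect_trans; apply; apply: (step_edge gG); rewrite ?inE.
Qed.

End MixedMenger.

(** * Chords *)

Ltac nat_lia :=
  repeat match goal with
  | H : forall _, _ |- _ => clear H
  | H : is_true ?b |- _ =>
      lazymatch b with
      | context [leq _ _] => fail
      | context [@eq_op _ (_ : nat) _] => fail
      | _ => clear H
      end
  end; lia.

Section Chords.

Variables (T E : finType) (ends : E -> {set T}) (G : graph T E).
Variables (R Q : {set T}) (D : rel T).
Hypothesis wfG : well_formed ends G.

Local Notation cut := (cut_edges ends G).

Lemma cut_ends (X : {set T}) g : g \in cut X ->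
  exists x y, [/\ g \in edges G, ends g = [set x; y], x \in X & y \notin X].
Proof.
move=> gX; have gG : g \in edges G by move: gX; rewrite inE => /andP[].
have [x [y [gxy _ _ _]]] := wf_ends wfG gG.
move: gX; rewrite (in_cut_edges _ wfG gG gxy).
have [xX|xX] := boolP (x \in X); have [yX|yX] := boolP (y \in X) => // _.
  by exists x, y.
by exists y, x; split=> //; rewrite setUC.
Qed.

Lemma cut_setD1 (X : {set T}) z g :
  g \in cut (X :\ z) -> g \in cut X \/ z \in ends g.
Proof.
case/cut_ends=> x [y [gG gxy /setD1P[nxz xX]]].
rewrite in_setD1 negb_and negbK => /orP[/eqP <-|yX]; [right | left].
  by rewrite gxy !inE eqxx orbT.
by rewrite (in_cut_edges _ wfG gG gxy) xX (negPf yX).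
Qed.

(* D u v is the relation "r u v = 2". *)
Hypothesis D_R : forall u v, D u v -> u \in R /\ v \in R.
Hypothesis D_robust : forall u v, D u v -> robust ends Q G u v.
Hypothesis D_critical : forall e x y, e \in edges G -> ends e = [set x; y] ->
  exists S : {set T}, [/\ x \notin S, y \in S &
    {in cut S, forall g, g = e} \/
    exists u v b, [/\ D u v, u \in S, v \notin S, breaker Q u v b
                    & {in cut S, forall g, g = e \/ hit ends b g}]].

(** The chord to be refuted. Its ends are exempt from [w_inner], so they may lie in [R]. *)
Variables (w : nat -> T) (ed : nat -> E) (n : nat).
Hypothesis ed_edges : forall i, i < n -> ed i \in edges G.
Hypothesis ed_ends : forall i, i < n -> ends (ed i) = [set w i; w i.+1].
Hypothesis w_inner : forall i, 0 < i < n -> w i \in Q :\: R.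
Hypothesis w_inj : forall i j, 0 < i <= n -> 0 < j <= n -> w i = w j -> i = j.
Hypothesis w0_neq : forall i, 0 < i < n -> w 0 != w i.
Hypothesis ed_inj : forall i j, i < n -> j < n -> ed i = ed j -> i = j.
(* The chord may be closed: this is void if w 0 = w n. *)
Hypothesis ends_robust : forall i, i < n ->
  robust ends Q (delete_edge G (ed i)) (w 0) (w n).

Lemma w_eq i j : w i = w j -> i <= n -> j <= n ->
  [\/ i = j, i = 0 /\ j = n | i = n /\ j = 0].
Proof.
case: i j => [|i] [|j] wij iN jN; first by constructor 1.
- have [jn|jn] := eqVneq j.+1 n; first by constructor 2.
  have /w0_neq : 0 < j.+1 < n by rewrite /= ltn_neqAle jn.
  by rewrite wij eqxx.
- have [jn|jn] := eqVneq i.+1 n; first by constructor 3.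
  have /w0_neq : 0 < i.+1 < n by rewrite /= ltn_neqAle jn.
  by rewrite wij eqxx.
- by constructor 1; apply: w_inj.
Qed.

Lemma ed_touch i m : i < n -> w m \in ends (ed i) -> w m = w i \/ w m = w i.+1.
Proof. by move=> iN; rewrite ed_ends // !inE => /orP[]/eqP; [left | right]. Qed.

Lemma side_const (S : {set T}) a b : a <= b -> b <= n ->
  (forall k, a <= k < b -> ed k \notin cut S) -> (w a \in S) = (w b \in S).
Proof.
elim: b => [|b IH]; first by rewrite leqn0 => /eqP->.
rewrite leq_eqVlt => /predU1P[-> //|ab] bN nocut.
rewrite IH // ?(ltnW bN) // => [|k /andP[ak kb]]; last first.
  by apply: nocut; rewrite ak ltnW.
have := nocut b; rewrite ltnSn andbT => /(_ ab).
rewrite (in_cut_edges _ wfG (ed_edges bN) (ed_ends bN)) negbK.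
by move/eqP.
Qed.

Lemma inner_not_terminal i u v : 0 < i < n -> D u v ->
  w i \in Q :\: [set u; v].
Proof.
move=> /w_inner; rewrite !inE => /andP[wR wQ] /D_R[uR vR]; rewrite wQ andbT.
by apply/norP; split; apply: contraNneq wR => ->.
Qed.

(** Otherwise one breaker would hit the whole cut that is left after deleting [ed i], against
    [ends_robust]. *)
Lemma chord_ends_same_side i (S : {set T}) b : i < n ->
  breaker Q (w 0) (w n) b -> {in cut S, forall g, g = ed i \/ hit ends b g} ->
  (w 0 \in S) = (w n \in S).
Proof.
move=> iN bb cS; apply/eqP/negPn/negP=> nS.
have [g] := ends_robust iN nS bb; rewrite cut_delete_edge !inE => /andP[ng gG] nh.
case: (cS g); rewrite ?inE ?gG // => h; first by rewrite h eqxx in ng.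
by rewrite h in nh.
Qed.

(** The breaker of the tight cut of [ed i] must meet the rest of the chord: otherwise [w 0], joined
    to [w i], would be outside [S], and [w n], joined to [w i.+1], inside, against [ends_robust]. It
    is traded for a node [w m] of the chord. The last two conditions keep [w n] out of [S :\ w m]
    for [m] beyond [i.+1], and index the base of a closed chord by [n] rather than 0. *)
Lemma chord_edge_cut i : i < n -> exists (S : {set T}) m u v,
  [/\ D u v, u \in S, v \notin S, w i \notin S & w i.+1 \in S] /\
  [/\ m <= n, m != i, m != i.+1, w m \in Q :\: [set u; v]
    & {in cut S, forall g, g = ed i \/ w m \in ends g}] /\
  (i.+1 < m -> w n \in S -> m = n) /\ (m = 0 -> w 0 != w n).
Proof.
move=> iN; have [S [wiS wiS' HS]] := D_critical (ed_edges iN) (ed_ends iN).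
have w0S : (forall k, k < i -> ed k \notin cut S) -> w 0 \notin S.
  by move=> nocut; rewrite (@side_const S 0 i) // ltnW.
have wnS : (forall k, i < k < n -> ed k \notin cut S) -> w n \in S.
  by move=> nocut; rewrite -(@side_const S i.+1 n).
(* A node of [Q] meeting the whole cut would separate [u] from [v]. *)
have touched_all z u v : z \in Q :\: [set u; v] -> D u v -> u \in S -> v \notin S ->
    ~ {in cut S, forall g, z \in ends g}.
  move=> zQ Duv uS vS all_z.
  have nS : (u \in S) != (v \in S) by rewrite uS (negPf vS).
  have [g gS] := D_robust Duv nS (zQ : breaker Q u v (inr z)).
  by rewrite /= all_z.
have split_ends b : breaker Q (w 0) (w n) b ->
    {in cut S, forall g, g = ed i \/ hit ends b g} ->
    (forall k, k < n -> k != i -> ~~ hit ends b (ed k)) -> False.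
  move=> bb cS nhit.
  have nocut k : k < n -> k != i -> ed k \notin cut S.
    move=> kN ki; apply/negP=> /cS[|]; last exact/negP/nhit.
    by move/(ed_inj kN iN)/eqP; apply/negP.
  have := chord_ends_same_side iN bb cS.
  rewrite wnS => [|k /andP[ik kN]]; last by rewrite nocut // gtn_eqF.
  by apply/negP/w0S => k ki; rewrite nocut ?(ltn_trans ki) // ltn_eqF.
case: HS => [cS|[u [v [b [Duv uS vS]]]]].
  (* A bridge serves as its own breaker. *)
  case: (@split_ends (inl (ed i))) => // [g /cS -> //|k kN]; first by left.
  by apply: contraNN => /eqP/(ed_inj kN iN)/eqP.
case: b => [f _ cS|z /= zQ cS]; last first.
  have zi : z \notin ends (ed i).
    apply/negP=> zi; apply: (touched_all z u v) => // g /cS[->|] //.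
  have [/existsP[m0 /eqP Ez]|noz] := boolP [exists m : 'I_n.+1, w m == z]; last first.
    have noz' k : k <= n -> w k != z.
      move=> kN; apply: contra noz => kz; apply/existsP.
      by exists (Ordinal (kN : k < n.+1)).
    exfalso; apply: (@split_ends (inr z)) => [|//|k kN _]; last first.
      by rewrite /= (ed_ends kN) !inE ![z == _]eq_sym !negb_or !noz' // ltnW.
    rewrite /= !inE ![z == _]eq_sym negb_or !noz' //=.
    by case/setDP: zQ.
  have [m [mN Em m0n]] : exists m, [/\ m <= n, w m = z & m = 0 -> w 0 != w n].
    have m0N : m0 <= n by rewrite -ltnS.
    have [w0n|nw0n] := eqVneq (w 0) (w n); last by exists m0.
    have [Em|nm] := eqVneq (val m0) 0.
      exists n; split=> // [|n0]; first by rewrite -Ez -w0n -Em.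
      by rewrite n0 in iN.
    by exists m0; split=> // m00; case/eqP: nm.
  have {}cS : {in cut S, forall g, g = ed i \/ w m \in ends g} by rewrite Em.
  rewrite -Em in zi zQ; exists S, m, u, v; split=> //; split.
    have /norP[z1 z2] : ~~ ((w m == w i) || (w m == w i.+1)).
      by move: zi; rewrite ed_ends // !inE.
    split=> //.
      by apply: contraNneq z1 => ->.
    by apply: contraNneq z2 => ->.
  (* For [m < n] the node [w m] differs from both ends and so is a breaker for them, while the chord
     before [ed i] avoids it and keeps [w 0] outside [S]. *)
  split=> // im wnSt; apply/eqP; rewrite eqn_leq mN leqNgt; apply/negP=> mn.
  have m_pos : 0 < m by apply: leq_trans im.
  have nw0S : w 0 \notin S.
    apply: w0S => k ki; have kN := ltn_trans ki iN.
    apply/negP=> /cS[/(ed_inj kN iN)|/(ed_touch kN)[]/w_eq]; first by nat_lia.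
      by move/(_ mN (ltnW kN))=> []; nat_lia.
    by move/(_ mN kN)=> []; nat_lia.
  have bm : breaker Q (w 0) (w n) (inr (w m) : E + T).
    have wmQ : w m \in Q by move: zQ; rewrite in_setD => /andP[].
    have m0' : w m != w 0 by apply/eqP=> /w_eq /(_ mN (leq0n n)) []; nat_lia.
    have mn' : w m != w n by apply/eqP=> /w_eq /(_ mN (leqnn n)) []; nat_lia.
    by rewrite /breaker !inE negb_or m0' mn'.
  by move: nw0S; rewrite (chord_ends_same_side iN bm cS) wnSt.
have [/existsP[j0 /eqP Ef]|nof] := boolP [exists j : 'I_n, ed j == f]; last first.
  case: (@split_ends (inl f)) => [//||k kN _ /=]; first by move=> g /cS[->|/eqP->]; [left | right => /=].
  by apply: contra nof => /eqP kf; apply/existsP; exists (Ordinal kN); apply/eqP.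
have [j jN {}Ef] : exists2 j, j < n & ed j = f by exists j0; rewrite ?ltn_ord.
have {}cS : {in cut S, forall g, g = ed i \/ g = ed j}.
  by move=> g /cS[->|/eqP->]; [left | right].
have [ij|ji|ij] := ltngtP i j; last first.
- case: (@split_ends (inl (ed i))) => // [g /cS|k kN ki].
    by rewrite ij => -[->|->]; left.
  by apply: contraNN ki => /eqP/(ed_inj kN iN)->.
(* The edge [ed j] is replaced by its endnode nearer to [ed i], which is inner. If that node were on
   [ed i], it would meet the whole cut. *)
- have mi : j.+1 != i.
    apply/eqP=> Ei; apply: (touched_all (w i) u v) => //.
      by apply: inner_not_terminal => //; nat_lia.
    by move=> g /cS[]->; rewrite ed_ends // !inE ?Ei eqxx ?orbT.
  exists S, j.+1, u, v; split=> //; split.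
    split; try nat_lia; first by apply: inner_not_terminal => //; nat_lia.
    by move=> g /cS[->|->]; [left | right; rewrite ed_ends // !inE eqxx orbT].
  by split; nat_lia.
- have mi : j != i.+1.
    apply/eqP=> Ei; apply: (touched_all (w i.+1) u v) => //.
      by apply: inner_not_terminal => //; nat_lia.
    by move=> g /cS[]->; rewrite ed_ends // !inE ?Ei eqxx ?orbT.
  exists S, j, u, v; split=> //; split.
    split; try nat_lia; first by apply: inner_not_terminal => //; nat_lia.
    by move=> g /cS[->|->]; [left | right; rewrite ed_ends // !inE eqxx].
  split; last nat_lia.
  move=> _ wnSt; have nw0S : w 0 \notin S.
    apply: w0S => k ki; have kN := ltn_trans ki iN.
    by apply/negP=> /cS[/(ed_inj kN iN)|/(ed_inj kN jN)]; nat_lia.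
  have cS' : {in cut S, forall g, g = ed i \/ hit ends (inl (ed j)) g}.
    by move=> g /cS[->|->]; [left | right => /=].
  by move: nw0S; rewrite (chord_ends_same_side iN _ cS') ?wnSt.
Qed.

(* (A, A + w j) is a tight biset crossed by the chord exactly at its i-th edge
   and at w j. *)
Definition tight i j := exists (A : {set T}) u v,
  [/\ D u v, u \in A, v \notin A, w j != v & w j \in Q] /\
  [/\ w i.+1 \in A, w i \notin A, w j \notin A, w n \notin A
    & {in cut A, forall g, g = ed i \/ w j \in ends g}].

(* The biset is uncrossed with the cut S of the next edge i.+1 of the chord,
   either to a shorter tight biset or to a single node separating u from v. *)
Lemma no_tight i j : i.+1 < j <= n -> ~ tight i j.
Proof.
have [l] := ubnP (j - i); elim: l i j => // l IHl i j ltl /andP[ij jN].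
move=> [A [u [v [[Duv uA vA wjv wjQ] [wi1A wiA wjA wnA cA]]]]].
have i1N : i.+1 < n := leq_trans ij jN.
have iN : i < n := ltnW i1N.
have [S [m [u' [v' [[Duv' uS' vS' wi1S wi2S]]]]]] := chord_edge_cut i1N.
case=> -[mN mi1 mi2 wmQuv cS] [mn m0]; move: (wmQuv); rewrite in_setD => /andP[wmuv wmQ].
(* If [w m] lies on the segment beyond [i.+2], the cut [S] alone gives a shorter tight biset. *)
have [mj|nmj] := boolP (i.+2 < m <= j).
  case: (@IHl i.+1 m); [nat_lia | nat_lia |]; exists (S :\ w m), u', v'.
  move: wmuv; rewrite !inE negb_or => /andP[wmu wmv]; split; split=> //.
  - by rewrite eq_sym wmu.
  - by rewrite negb_and vS' orbT.
  - rewrite wi2S andbT; apply/eqP=> /w_eq.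
    by move=> /(_ i1N mN)[]; nat_lia.
  - by rewrite negb_and wi1S orbT.
  - by rewrite eqxx.
  - rewrite negb_and negbK; have [wnS|] := boolP (w n \in S); last by rewrite orbT.
    by rewrite mn ?eqxx //; case/andP: mj.
  - by move=> g /cut_setD1[/cS|]; last by right.
(* Now [w m] is off the segment, and the chord joins it to [w i] or to [w n] without crossing
   [A]. *)
have wmA : w m \notin A.
  have [mi|mi] := leqP m i.
    rewrite (@side_const A m i) ?(ltnW iN) // => k /andP[mk ki].
    have kN : k < n by nat_lia.
    apply/negP=> /cA[/(ed_inj kN iN)|/(ed_touch kN)[] Ew]; first by nat_lia.
      have [||[jn k0]] := w_eq Ew jN (ltnW kN); try nat_lia.
      have m_0 : m = 0 by nat_lia.
      by move: (m0 m_0); rewrite -jn Ew k0 eqxx.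
    by have [] := w_eq Ew jN kN; nat_lia.
  rewrite (@side_const A m n) // => k /andP[mk kN].
  apply/negP=> /cA[/(ed_inj kN iN)|/(ed_touch kN)[] /w_eq]; first by nat_lia.
    by move/(_ jN (ltnW kN))=> []; nat_lia.
  by move/(_ jN kN)=> []; nat_lia.
have wmj : w m != w j.
  apply/eqP=> Ew; have [|[m_0 jn]|] := w_eq Ew mN jN; try nat_lia.
  by move: (m0 m_0); rewrite -jn -Ew m_0 eqxx.
have wjS : w j \in S.
  rewrite -(@side_const S i.+2 j) // => k /andP[ik kj]; have kN := leq_trans kj jN.
  apply/negP=> /cS[/(ed_inj kN i1N)|/(ed_touch kN)[] Ew]; first by nat_lia.
    by have [] := w_eq Ew mN (ltnW kN); nat_lia.
  have [|[m_0 k1]|] := w_eq Ew mN kN; try nat_lia.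
  by move: (m0 m_0); rewrite -k1 -Ew m_0 eqxx.
(* An edge leaving [A :&: S] inside [A] crosses [S] away from [w m], hence is [ed i.+1]. An edge
   leaving [A] is at [w j], since [ed i] has no end in [A :&: S]. *)
have cAS : {in cut (A :&: S), forall g, g = ed i.+1 \/ w j \in ends g}.
  move=> g /cut_ends[x [y [gG gxy /setIP[xA xS]]]].
  rewrite in_setI negb_and => yAS.
  have [yA|yA] := boolP (y \in A); last first.
    have [|Eg|] := cA g; [ | |by right].
      by rewrite (in_cut_edges _ wfG gG gxy) xA (negPf yA).
    have : x \in ends (ed i) by rewrite -Eg gxy !inE eqxx.
    rewrite ed_ends // !inE => /orP[]/eqP Ex; first by rewrite -Ex xA in wiA.
    by rewrite -Ex xS in wi1S.
  rewrite yA /= in yAS; have [||] := cS g; [|by left|].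
    by rewrite (in_cut_edges _ wfG gG gxy) xS (negPf yAS).
  by rewrite gxy !inE => /orP[]/eqP Em; rewrite Em ?xA ?yA in wmA.
(* An edge leaving [A :\: S] is [ed i], or it enters [S] away from [w m] and so is [ed i.+1]; both
   contain [w i.+1]. *)
have cADS : {in cut (A :\: S), forall g, w i.+1 \in ends g}.
  move=> g /cut_ends[x [y [gG gxy]]]; rewrite in_setD => /andP[xS xA].
  rewrite in_setD negb_and negbK => yAS.
  have touch_i : g = ed i -> w i.+1 \in ends g.
    by move->; rewrite ed_ends // !inE eqxx orbT.
  have touch_i1 : g = ed i.+1 -> w i.+1 \in ends g.
    by move->; rewrite ed_ends // !inE eqxx.
  have yS_touch : y \in S -> w m != y -> w i.+1 \in ends g.
    move=> yS my; have [||] := cS g; [|exact: touch_i1|].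
      by rewrite (in_cut_edges _ wfG gG gxy) (negPf xS) yS.
    rewrite gxy !inE (negPf my) orbF => /eqP Em.
    by rewrite Em xA in wmA.
  have [yA|yA] := boolP (y \in A).
    rewrite yA orbF in yAS; apply: yS_touch => //.
    by apply: contraNneq wmA => ->.
  have [||] := cA g; [|exact: touch_i|].
    by rewrite (in_cut_edges _ wfG gG gxy) xA (negPf yA).
  rewrite {1}gxy in_set2 => /orP[]/eqP Ej; first by rewrite Ej xA in wjA.
  by apply: yS_touch; rewrite -Ej.
have robust_at z (X : {set T}) : z \in Q :\: [set u; v] -> u \in X -> v \notin X ->
    ~ {in cut X, forall g, z \in ends g}.
  move=> zQ uX vX all_z; have nX : (u \in X) != (v \in X) by rewrite uX (negPf vX).
  have [g gX] := D_robust Duv nX (zQ : breaker Q u v (inr z)).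
  by rewrite /= all_z.
have [uS|uS] := boolP (u \in S); last first.
  apply: (robust_at (w i.+1) (A :\: S)) cADS.
  - by apply: inner_not_terminal.
  - by rewrite in_setD uS.
  - by rewrite in_setD negb_and vA orbT.
have uAS : u \in A :&: S by rewrite in_setI uA.
have vAS : v \notin A :&: S by rewrite in_setI negb_and vA.
(* For [j = i.+2] the edge [ed i.+1] ends in [w j], which then meets the whole cut of [A :&: S]. *)
have [ij2|ij2] := leqP j i.+2.
  have Ej : j = i.+2 by apply/eqP; rewrite eqn_leq ij2.
  apply: (robust_at (w j) (A :&: S)) => // [|g /cAS[->|] //].
    rewrite !inE wjQ negb_or wjv !andbT.
    by apply: contraNneq wjA => ->.
  by rewrite ed_ends // Ej !inE eqxx orbT.
case: (@IHl i.+1 j); [nat_lia | nat_lia |]; exists (A :&: S), u, v.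
split; split; rewrite // in_setI.
- rewrite wi2S andbT; apply/negPn/negP=> nA; have [||] := cA (ed i.+1).
  + by rewrite (in_cut_edges _ wfG (ed_edges i1N) (ed_ends i1N)) wi1A (negPf nA).
  + by move/(ed_inj i1N iN); nat_lia.
  + case/(ed_touch i1N)=> /w_eq; first by move/(_ jN iN)=> []; nat_lia.
    by move/(_ jN i1N)=> []; nat_lia.
- by rewrite negb_and wi1S orbT.
- by rewrite negb_and wjA.
- by rewrite negb_and wnA.
Qed.

(** Removing [w m] from the cut of the first edge gives a tight biset on the segment from 0 to
    [m]. *)
Theorem no_robust_chord : 0 < n -> False.
Proof.
move=> n_gt0; have [S [m [u [v [[Duv uS vS w0S w1S]]]]]] := chord_edge_cut n_gt0.
case=> -[mN m0 m1 wmQuv cS] [mn _].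
have m_gt1 : 1 < m by nat_lia.
apply: (@no_tight 0 m); first by rewrite m_gt1.
have [wmQ wmu wmv] : [/\ w m \in Q, w m != u & w m != v].
  by move: wmQuv; rewrite !inE negb_or => /andP[/andP[-> ->] ->].
exists (S :\ w m), u, v; split; split; rewrite // ?in_setD1 //.
- by rewrite eq_sym wmu.
- by rewrite negb_and vS orbT.
- by rewrite w1S andbT; apply/eqP=> /w_eq /(_ n_gt0 mN) []; nat_lia.
- by rewrite negb_and w0S orbT.
- by rewrite eqxx.
- rewrite negb_and negbK; have [wnS|] := boolP (w n \in S); last by rewrite orbT.
  by rewrite -(mn m_gt1 wnS) eqxx.
- by move=> g /cut_setD1[/cS|]; last by right.
Qed.

End Chords.

(** * Minimally connected graphs *)

Section PathPairs.

Variables (T E : finType) (ends : E -> {set T}) (G : graph T E) (Q : {set T}).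
Hypothesis wfG : well_formed ends G.

Lemma split_path (u x : T) (p : seq (E * T)) : x \in unzip2 p ->
  exists a b, p = a ++ b /\ last u (unzip2 a) = x.
Proof.
elim: p u => //= -[f y] p IH u; rewrite inE => /predU1P[->|/(IH y)[a [b [-> la]]]].
  by exists [:: (f, y)], p.
by exists ((f, y) :: a), b.
Qed.

(** [P1] crosses [S] before [p]. If [v] is on the side of [u], it crosses [S] again after [p];
    otherwise [P2] crosses [S] after [q]. One breaker cannot hit both crossings, as [P1] is simple
    and the paths are disjoint. *)
Lemma paths_unhit_cut u v P1 P2 p q (S : {set T}) b :
  is_uvpath ends G u v P1 -> is_uvpath ends G u v P2 -> Qdisjoint Q u v P1 P2 ->
  p \in unzip2 P1 -> q \in unzip2 P2 -> p != v ->
  (p \in S) != (q \in S) -> breaker Q p q b -> (u \in S) != (p \in S) ->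
  exists g, [/\ g \in cut_edges ends G S, ~~ hit ends b g
              & (g \in unzip1 P1) || (g \in unzip1 P2)].
Proof.
move=> /and3P[w1 /eqP l1 u1] /and3P[w2 /eqP l2 u2] /andP[/hasPn dE /hasPn dQ].
move=> /(split_path u)[a1 [b1 [E1 p1]]] /(split_path u)[a2 [b2 [E2 q2]]].
move=> npv npq bb nup; rewrite {P1}E1 {P2}E2 in w1 l1 u1 w2 l2 u2 dE dQ *.
have [wa1] := walk_cat w1 wfG; have [wa2] := walk_cat w2 wfG.
rewrite p1 q2 => wb2 wb1.
rewrite /unzip2 !map_cat -/unzip2 in l1 l2 u1 u2 dQ *.
rewrite !last_cat p1 in l1; rewrite !last_cat q2 in l2.
rewrite /unzip1 !map_cat -/unzip1 in dE *.
have [|||g1 g1a g1S] := @walk_cut _ _ ends G S u a1; rewrite ?p1 //.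
have [h1|nh1] := boolP (hit ends b g1); last first.
  by exists g1; rewrite mem_cat g1a.
move: u1; rewrite -cat_cons cat_uniq => /and3P[_ /hasPn dab _].
have [Sv|Sv] := eqVneq (p \in S) (v \in S); last first.
  have [|||g2 g2b g2S] := @walk_cut _ _ ends G S p b1; rewrite ?l1 //.
  have [h2|nh2] := boolP (hit ends b g2); last first.
    by exists g2; rewrite !mem_cat g2b orbT.
  (* The two parts of [P1] meet only in [p], so a common node other than [p] is a contradiction; a
     breaking edge has such an endnode. *)
  have [z [z1 z2 nzp]] : exists z, [/\ z \in ends g1, z \in ends g2 & z != p].
    case: b bb h1 h2 => [f _ /eqP Eg1 /eqP->|z zQ h1 h2]; last first.
      by exists z; split=> //; move: zQ; rewrite /= !inE negb_or -andbA => /andP[].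
    have [|x [y [gxy nxy _ _]]] := @wf_ends _ _ ends G g1 wfG.
      by move: g1S; rewrite inE => /andP[].
    rewrite -Eg1 gxy; have [Ex|nxp] := eqVneq x p; last by exists x; rewrite !inE eqxx.
    by exists y; rewrite !inE eqxx orbT -Ex eq_sym.
  have := walk_ends wb1 g2b z2; rewrite inE (negPf nzp) => /dab /=.
  by rewrite (walk_ends wa1 g1a z1).
have [|||g2 g2b g2S] := @walk_cut _ _ ends G S q b2; rewrite ?l2 -?Sv 1?eq_sym //.
have [h2|nh2] := boolP (hit ends b g2); last first.
  by exists g2; rewrite !mem_cat g2b !orbT.
exfalso; case: b bb h1 h2 => [f _ /eqP E1 /eqP E2|z /= + h1 h2].
  by have := dE g2; rewrite !mem_cat g2b orbT => /(_ isT); rewrite /= !mem_cat E2 -E1 g1a.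
rewrite !inE negb_or => /andP[/andP[nzp nzq] zQ].
have := walk_ends wb2 g2b h2; rewrite inE (negPf nzq) /= => z2.
have := walk_ends wa1 g1a h1; rewrite inE => /predU1P[zu|z1].
  by move: u2; rewrite /= mem_cat -zu z2 orbT.
have zu : z != u by apply: contraTneq z2 => ->; case/andP: u2; rewrite mem_cat => /norP[].
have zv : z != v.
  apply: contraTneq z1 => ->; apply/negP=> v1.
  have vb1 : v \in unzip2 b1.
    move: l1 npv; case: (b1) => [/= ->|[f y] c /= <- _]; first by rewrite eqxx.
    exact: mem_last.
  by have := dab _ vb1; rewrite /= inE v1 orbT.
have := dQ z; rewrite !mem_cat z2 orbT => /(_ isT).
by rewrite /= mem_cat z1 !inE (negPf zu) (negPf zv) zQ.
Qed.

(** As [S] separates [p] from [q], one of them is not on the side of [u], and exchanging the two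
    paths makes it [p]. The edge found lies on one of the paths, hence is not [e]. *)
Lemma paths_robust u v P1 P2 p q e :
  is_uvpath ends G u v P1 -> is_uvpath ends G u v P2 -> Qdisjoint Q u v P1 P2 ->
  p \in unzip2 P1 -> q \in unzip2 P2 -> p != v -> q != v ->
  e \notin unzip1 P1 -> e \notin unzip1 P2 ->
  robust ends Q (delete_edge G e) p q.
Proof.
move=> P1p P2p dis p1 q2 npv nqv e1 e2 S b npq bb.
suff [g [gS nh g12]] : exists g, [/\ g \in cut_edges ends G S, ~~ hit ends b g
    & (g \in unzip1 P1) || (g \in unzip1 P2)].
  exists g => //; rewrite cut_delete_edge in_setD1 gS andbT.
  by apply: contraTneq g12 => ->; rewrite negb_or e1 e2.
have [up|up] := eqVneq (u \in S) (p \in S); last first.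
  exact: (paths_unhit_cut P1p P2p dis p1 q2).
have [|||||||||g [gS nh g12]] := @paths_unhit_cut u v P2 P1 q p S b => //.
- by rewrite Qdisjoint_sym.
- by rewrite eq_sym.
- by move: bb; rewrite /breaker; case: (b) => // z; rewrite setUC.
- by rewrite up.
- by exists g; rewrite orbC.
Qed.

End PathPairs.

(** * Tight cuts from minimality *)

Section Minimal.

Variables (T E : finType) (ends : E -> {set T}) (G : graph T E).
Variables (R Q : {set T}) (r : T -> T -> nat).
Hypotheses (wfG : well_formed ends G) (RV : R \subset nodes G).
Hypothesis r_sym : forall u v, u \in R -> v \in R -> r u v = r v u.
Hypothesis r_012 : forall u v, u \in R -> v \in R -> r u v \in [:: 0; 1; 2].
Hypothesis minG : minimally_rQ_connected ends r R Q G.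

Definition demand2 : rel T :=
  fun u v => [&& u \in R, v \in R, u != v & r u v == 2].

Lemma demand2_sym u v : demand2 u v = demand2 v u.
Proof.
rewrite /demand2; case uR: (u \in R); case vR: (v \in R) => //=.
by rewrite eq_sym r_sym.
Qed.

Lemma demand2_R u v : demand2 u v -> u \in R /\ v \in R.
Proof. by case/and4P. Qed.

Lemma demand2_robust u v : demand2 u v -> robust ends Q G u v.
Proof.
case/and4P=> uR vR nuv /eqP r2; apply: Qlambda_robust => //.
by have := minG.1 u v uR vR nuv; rewrite r2; apply.
Qed.

(** Deleting [e] violates some demand. For a demand of 1 no path is left, so [e] is a bridge. For a
    demand of 2 one breaker hits the cut that remains, and [e] crosses it because [G] itself is
    robust. *)
Lemma demand2_critical e x y : e \in edges G -> ends e = [set x; y] ->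
  exists S : {set T}, [/\ x \notin S, y \in S &
    {in cut_edges ends G S, forall g, g = e} \/
    exists u v b, [/\ demand2 u v, u \in S, v \notin S, breaker Q u v b
      & {in cut_edges ends G S, forall g, g = e \/ hit ends b g}]].
Proof.
move=> eG exy; pose H := delete_edge G e.
have wfH : well_formed ends H by apply: wf_delete_edge.
have propH : proper_subgraph ends H G.
  split=> //; first exact: subsetDl.
  by move=> HG; have : e \in edges H by [rewrite HG]; rewrite !inE eqxx.
have [/existsP[u /existsP[v /and5P[uR vR nuv r_gt0 ltr]]]|no] :=
  boolP [exists u, exists v, [&& u \in R, v \in R, u != v, 0 < r u v
    & Qlambda ends Q H u v < r u v]]; last first.
  case: (minG.2 H propH) => u v uR vR nuv r_gt0; rewrite leqNgt.
  apply: contra no => ltr; apply/existsP; exists u; apply/existsP; exists v.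
  exact/and5P.
have lamG := minG.1 u v uR vR nuv r_gt0.
have uH : u \in nodes H by apply: (subsetP RV).
have [S [uS vS eS cS]] : exists S : {set T}, [/\ u \in S, v \notin S,
    e \in cut_edges ends G S & {in cut_edges ends G S, forall g, g = e} \/
    exists b, [/\ demand2 u v, breaker Q u v b
      & {in cut_edges ends G S, forall g, g = e \/ hit ends b g}]].
  have [r1|r1] := leqP (r u v) 1.
    have l0 : Qlambda ends Q H u v = 0 by lia.
    have [S [uS vS cS]] := Qlambda0_cut wfH uH l0; exists S.
    have cS' g : g \in cut_edges ends G S -> g = e.
      move=> gS; have := in_set0 g; rewrite -cS cut_delete_edge in_setD1 gS andbT.
      by move/negbFE/eqP.
    have nS : (u \in S) != (v \in S) by rewrite uS (negPf vS).
    have [g gS] := Qlambda_linked wfG (leq_trans r_gt0 lamG) nS.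
    by split=> //; [rewrite -(cS' g gS) | left].
  have r2 : r u v = 2 by have := r_012 uR vR; rewrite !inE; lia.
  have [lt1|[S [b [uS vS bb cS]]]] := Qlambda_or_cut Q wfH uH nuv e; first lia.
  exists S.
  have cS' : {in cut_edges ends G S, forall g, g = e \/ hit ends b g}.
    move=> g gS; have [->|nge] := eqVneq g e; [by left | right].
    by apply: cS; rewrite cut_delete_edge in_setD1 nge.
  have Duv : demand2 u v by apply/and4P; rewrite r2.
  have nS : (u \in S) != (v \in S) by rewrite uS (negPf vS).
  have [g gS nh] := demand2_robust Duv nS bb.
  split=> //; last by right; exists b.
  by case: (cS' g gS) => [<- //|]; rewrite (negPf nh).
move: (eS); rewrite (in_cut_edges _ wfG eG exy).
have [xS|xS] := boolP (x \in S); have [yS|yS] := boolP (y \in S) => // _; last first.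
  exists S; split=> //; case: cS => [|[b [Duv bb cS]]]; first by left.
  by right; exists u, v, b.
(* The opposite orientation is repaired by complementing [S] and exchanging [u] and [v]. *)
exists (~: S); rewrite !inE xS yS cut_edgesC //; split=> //.
case: cS => [|[b [Duv bb cS]]]; first by left.
right; exists v, u, b; rewrite demand2_sym !inE uS vS; split=> //.
by move: bb; rewrite /breaker; case: (b) => // z; rewrite setUC.
Qed.

Definition no_chord := no_robust_chord wfG demand2_R demand2_robust demand2_critical.

End Minimal.

(** * Components *)

Section Components.

Variables (T E : finType) (ends : E -> {set T}) (G : graph T E).
Variables (R Q : {set T}) (r : T -> T -> nat).
Hypotheses (wfG : well_formed ends G) (RV : R \subset nodes G).
Hypothesis QRV : Q :|: R = nodes G.
Hypothesis r_sym : forall u v, u \in R -> v \in R -> r u v = r v u.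
Hypothesis r_012 : forall u v, u \in R -> v \in R -> r u v \in [:: 0; 1; 2].
Hypothesis minG : minimally_rQ_connected ends r R Q G.

Lemma adj_sym (H : graph T E) : symmetric (adj ends H).
Proof. by move=> x y; apply: eq_existsb => e; rewrite setUC. Qed.

Lemma adjP (H : graph T E) x y :
  reflect (exists2 e, e \in edges H & ends e = [set x; y]) (adj ends H x y).
Proof.
apply: (iffP existsP) => [[e /andP[eH /eqP]]|[e eH exy]]; first by exists e.
by exists e; rewrite eH exy eqxx.
Qed.

Lemma choose_edges (w : nat -> T) N (e0 : E) :
  (forall k, k < N -> adj ends G (w k) (w k.+1)) ->
  exists ed : nat -> E, forall k, k < N ->
    ed k \in edges G /\ ends (ed k) = [set w k; w k.+1].
Proof.
move=> adjw; pose P k := [pred e in edges G | ends e == [set w k; w k.+1]].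
exists (fun k => odflt e0 [pick e in P k]) => k /adjw/adjP[e eG exy].
case: pickP => [f /andP[fG /eqP]//|/(_ e)] /=.
by rewrite !inE eG exy eqxx.
Qed.

Lemma edge_index_inj (w : nat -> T) (ed : nat -> E) N i j :
  (forall a b, a <= N -> b <= N -> w a = w b -> a = b) ->
  (forall k, k < N -> ends (ed k) = [set w k; w k.+1]) ->
  i < N -> j < N -> ed i = ed j -> i = j.
Proof.
move=> w_inj ed_ends iN jN Eij.
have ends_ij : [set w i; w i.+1] = [set w j; w j.+1] by rewrite -!ed_ends // Eij.
have := set21 (w i) (w i.+1); have := set22 (w i) (w i.+1).
rewrite ends_ij => /set2P[] /w_inj E1 /set2P[] /w_inj E2; lia.
Qed.

(** The piece of [w] that ends at its first node on [P1] and starts at the last earlier node on [P2]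
    has no edge on either path, and so is a chord with robust ends. The condition [0 < k] lets [w 0]
    lie in [R], as a node of Gamma(C) does. *)
Lemma no_theta u v P1 P2 (w : nat -> T) N :
  is_uvpath ends G u v P1 -> is_uvpath ends G u v P2 -> Qdisjoint Q u v P1 P2 ->
  (forall k, k <= N -> w k \in Q :\: [set u; v]) ->
  (forall k, 0 < k <= N -> w k \notin R) ->
  (forall a b, a <= N -> b <= N -> w a = w b -> a = b) ->
  (forall k, k < N -> adj ends G (w k) (w k.+1)) ->
  w 0 \in unzip2 P2 -> w N \in unzip2 P1 -> False.
Proof.
move=> P1p P2p dis wQ wR w_inj w_adj w0 wN.
have ex_j : exists j, w j \in unzip2 P1 by exists N.
have [j j1 j_min] := ex_minnP ex_j; have jN := j_min _ wN.
have ex_i : exists i, (i <= j) && (w i \in unzip2 P2) by exists 0.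
have bnd i : (i <= j) && (w i \in unzip2 P2) -> i <= j by case/andP.
have [i /andP[ij i2] i_max] := ex_maxnP ex_i bnd.
have {ij} ij : i < j.
  rewrite ltn_neqAle ij andbT; apply/eqP=> Eij; rewrite Eij in i2.
  case/andP: dis => _ /hasPn/(_ _ i2)/negP; apply; apply/andP; split=> //.
  exact: wQ.
have [|e0 _ _] := adjP _ _ _ (w_adj i _); first nat_lia.
have [ed edP] := choose_edges e0 w_adj.
have nw k : k <= N -> w k != u /\ w k != v.
  by move=> /wQ; rewrite !inE negb_or => /andP[/andP[]].
have ed_touch k z P : k < N -> z \in ends (ed k) -> is_uvpath ends G u v P ->
    z != u -> ed k \in unzip1 P -> z \in unzip2 P.
  move=> kN zk /and3P[wP _ _] nzu ekP.
  by have := walk_ends wP ekP zk; rewrite inE (negPf nzu).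
apply: (@no_chord T E ends G R Q r wfG RV r_sym r_012 minG
  (fun k => w (i + k)) (fun k => ed (i + k)) (j - i)).
- by move=> k kN; have [] := edP (i + k) ltac:(nat_lia).
- by move=> k kN; rewrite addnS; have [] := edP (i + k) ltac:(nat_lia).
- move=> k kN; have := wQ (i + k) ltac:(nat_lia).
  by rewrite !inE => /andP[_ ->]; rewrite wR //; nat_lia.
- by move=> a b aN bN /w_inj; nat_lia.
- by move=> k kN; apply/eqP=> /w_inj; nat_lia.
- move=> a b aN bN /(edge_index_inj w_inj (fun k kN => (edP k kN).2)); nat_lia.
- move=> k kN; rewrite addn0 subnKC ?(ltnW ij) //.
  have kN' : i + k < N by nat_lia.
  have [_ ek] := edP _ kN'.
  apply: (paths_robust wfG P2p P1p) => //.
  + by rewrite Qdisjoint_sym.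
  + by have [] := nw i ltac:(nat_lia).
  + by have [] := nw j ltac:(nat_lia).
  + apply/negP=> /(ed_touch _ (w (i + k).+1) _ kN'); rewrite ek set22.
    move/(_ isT P2p (nw _ kN').1) => h.
    by have := i_max (i + k).+1; rewrite h andbT; nat_lia.
  + apply/negP=> /(ed_touch _ (w (i + k)) _ kN'); rewrite ek set21.
    move/(_ isT P1p (nw _ (ltnW kN')).1) => /j_min; nat_lia.
- nat_lia.
Qed.

Lemma no_theta_path u v P1 P2 x p :
  is_uvpath ends G u v P1 -> is_uvpath ends G u v P2 -> Qdisjoint Q u v P1 P2 ->
  path (adj ends G) x p -> uniq (x :: p) ->
  {subset x :: p <= Q :\: [set u; v]} -> {in p, forall y, y \notin R} ->
  x \in unzip2 P2 -> last x p \in unzip2 P1 -> False.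
Proof.
move=> P1p P2p dis /(pathP x) pp up pQ pR x2 l1.
apply: (@no_theta u v P1 P2 (nth x (x :: p)) (size p)) => //.
- by move=> k kN; apply: pQ; apply: mem_nth.
- by case=> // k kN; apply: pR; apply: mem_nth.
- by move=> a b aN bN /eqP; rewrite nth_uniq // => /eqP.
- by rewrite nth_last.
Qed.

(** * A single R-component *)

Section OneComponent.

Variable C : {set T}.
Hypothesis compC : C \in components ends (graphD ends G R).

Local Notation GR := (graphD ends G R).
Local Notation K := (Rcomponent ends G C).

Lemma component_nodes : C \subset nodes G :\: R.
Proof.
case/imsetP: compC => x _ ->; apply/subsetP=> y.
by rewrite inE => /andP[].
Qed.

Lemma component_Q c : c \in C -> c \in Q.
Proof.
move/(subsetP component_nodes); rewrite -QRV !inE.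
by case/andP=> /negPf-> /orP[].
Qed.

Lemma component_notR c : c \in C -> c \notin R.
Proof. by move/(subsetP component_nodes); rewrite inE => /andP[]. Qed.

Lemma component_off_terminals u v c : u \in R -> v \in R -> c \in C ->
  c \in Q :\: [set u; v].
Proof.
move=> uR vR cC; have cR := component_notR cC.
rewrite !inE negb_or (component_Q cC) andbT.
by apply/andP; split; apply: contraNneq cR => ->.
Qed.

Lemma component_neq0 : exists c, c \in C.
Proof.
by case/imsetP: compC => x xG ->; exists x; rewrite inE xG connect0.
Qed.

Lemma component_step c y : c \in C -> adj ends G c y -> y \notin R -> y \in C.
Proof.
case/imsetP: compC => x _ ->; rewrite !inE => /andP[/andP[cR cG] xc].
move=> /adjP[e eG ecy] yR; rewrite yR (wf_nodes wfG eG) ?ecy ?set22 //=.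
apply: connect_trans xc _; apply: connect1; apply/adjP; exists e => //.
rewrite inE eG disjoint_subset; apply/subsetP=> z; rewrite ecy !inE.
by case/orP=> /eqP->.
Qed.

Lemma adj_graphD x y : adj ends GR x y -> adj ends G x y /\ y \notin R.
Proof.
case/adjP=> e; rewrite inE => /andP[eG dis] exy; split; first by apply/adjP; exists e.
by rewrite (disjointFr dis) // exy set22.
Qed.

Lemma component_path c d : c \in C -> d \in C -> exists p,
  [/\ path (adj ends G) c p, last c p = d, uniq (c :: p) & {subset c :: p <= C}].
Proof.
move=> cC dC; have /connectP[p0 /shortenP[p pp up _] ld] : connect (adj ends GR) c d.
  move: cC dC; case/imsetP: compC => x _ ->; rewrite !inE => /andP[_ xc] /andP[_ xd].
  by apply: connect_trans xd; rewrite sym_connect_sym //; apply: adj_sym.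
exists p; split=> //; first by apply: sub_path pp => x y /adj_graphD[].
elim: p c cC pp {up ld d dC} => [|y p IH] c cC /=; first by move=> _ z /[!inE] /eqP->.
case/andP=> /adj_graphD[cy yR] pp z; rewrite inE => /predU1P[-> //|].
by apply: IH => //; apply: component_step cy yR.
Qed.

Lemma neighbors_R y : y \in neighbors ends G C -> y \in R.
Proof.
rewrite inE => /andP[/setDP[_ yC] /existsP[c /andP[cC cy]]].
by apply: contraR yC => /(component_step cC cy).
Qed.

Lemma Rcomponent_adj c y : c \in C -> adj ends G c y -> adj ends K c y.
Proof.
move=> cC /adjP[e eG ecy]; apply/adjP; exists e => //.
rewrite in_setU (in_cut_edges C wfG eG ecy) cC inE eG ecy subUset !sub1set cC /=.
by case: (y \in C).
Qed.

Lemma Rcomponent_edge e x y : e \in edges K -> ends e = [set x; y] ->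
  e \in edges G /\ (x \in C \/ y \in C).
Proof.
rewrite in_setU => eK exy; have eG : e \in edges G.
  by case/orP: eK; rewrite inE => /andP[].
move: eK; rewrite (in_cut_edges C wfG eG exy) inE eG exy subUset !sub1set /=.
by case xC: (x \in C); case yC: (y \in C) => //= _; split; auto.
Qed.

Lemma Rcomponent_connected : connected ends K.
Proof.
have [c0 c0C] := component_neq0; split.
  by apply/set0Pn; exists c0; rewrite in_setU c0C.
have symK := sym_connect_sym (@adj_sym K).
suff to_c0 x : x \in nodes K -> connect (adj ends K) c0 x.
  by move=> x y /to_c0 c0x /to_c0 c0y; apply: connect_trans c0y; rewrite symK.
have inC d : d \in C -> connect (adj ends K) c0 d.
  move=> dC; have [p [pp <- _ pC]] := component_path c0C dC.
  apply/connectP; exists p => //; elim: p (c0) pp pC => //= y p IH c /andP[cy pp] pC.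
  rewrite Rcomponent_adj ?pC ?mem_head //= IH // => z zp.
  by apply: pC; rewrite inE zp orbT.
rewrite in_setU => /orP[/inC//|]; rewrite inE => /andP[_ /existsP[d /andP[dC dx]]].
by apply: connect_trans (inC d dC) _; apply: connect1; apply: Rcomponent_adj.
Qed.

(** This makes the robustness required of the ends of a chord vacuous for closed chords. *)
Lemma robust_refl H x : robust ends Q H x x.
Proof. by move=> S b; rewrite eqxx. Qed.

(** Two edges from [y] into [C], completed by a path inside [C], would form a closed chord based at
    [y], with all inner nodes in [C]. *)
Lemma neighbor_edge_uniq y c d e f : y \notin C -> c \in C -> d \in C ->
  e \in edges G -> f \in edges G -> ends e = [set y; c] -> ends f = [set d; y] ->
  e = f.
Proof.
move=> yC cC dC eG fG eyc fdy; apply/eqP/negPn/negP=> nef.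
have [p [pp lp up pC]] := component_path cC dC.
(* Position [n] is just past the end of the list, so the default [y] closes the walk. *)
pose w := nth y [:: y, c & p]; pose n := (size p).+2.
have wC k : 0 < k < n -> w k \in C.
  by case: k => // k kn; apply: pC; rewrite /w /= mem_nth.
have wn : w n = y by rewrite /w nth_default.
have w_inj a b : 0 < a <= n -> 0 < b <= n -> w a = w b -> a = b.
  move=> a_n b_n; have [an|an] := eqVneq a n; have [bn|bn] := eqVneq b n.
  - by rewrite an.
  - by rewrite an wn => Ey; rewrite Ey wC // in yC; nat_lia.
  - by rewrite bn wn => Ey; rewrite -Ey wC // in yC; nat_lia.
  case: a b a_n b_n an bn => [//|a] [//|b] a_n b_n an bn /eqP.
  have aP : a < size (c :: p) by rewrite /=; nat_lia.
  have bP : b < size (c :: p) by rewrite /=; nat_lia.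
  by rewrite /w /= (nth_uniq y aP bP up) => /eqP->.
have w_adj k : k < size p -> adj ends G (w k.+1) (w k.+2).
  by move=> kp; have /(pathP y)/(_ k kp) := pp.
have [ed edP] := choose_edges (w := fun k => w k.+1) e w_adj.
pose ed' k := if k == 0 then e else if k == n.-1 then f else ed k.-1.
have edE k : k < n -> ed' k \in edges G /\ ends (ed' k) = [set w k; w k.+1].
  move=> kn; rewrite /ed'; have [->|k0] := eqVneq k 0; first by [].
  have [->|kn1] := eqVneq k n.-1; last first.
    have := edP k.-1; rewrite prednK ?lt0n //; apply; nat_lia.
  split=> //; rewrite fdy -[in RHS]/n wn; congr [set _; _].
  by rewrite /w /= -lp (last_nth y).
have in_e k : 0 < k < n.-1 -> y \notin ends (ed' k).
  move=> kn; have [|_ ->] := edE k; first by nat_lia.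
  rewrite !inE negb_or; apply/andP; split; apply: contraNneq yC => ->; apply: wC; nat_lia.
apply: (@no_chord T E ends G R Q r wfG RV r_sym r_012 minG w ed' n) => //.
- by move=> k /edE[].
- by move=> k /edE[].
- by move=> k /wC kC; rewrite in_setD (component_notR kC) (component_Q kC).
- by move=> k /wC kC; apply: contraNneq yC => wk; rewrite -[y]/(w 0) wk.
- have y0 : y \in ends (ed' 0) by rewrite eyc set21.
  have yn : y \in ends (ed' n.-1) by rewrite /ed' eqxx fdy set22.
  (* If [c = d], the edges [e] and [f] are parallel, so endnodes alone do not tell them apart. *)
  have n0 : ed' 0 <> ed' n.-1 by rewrite /ed' /n /= eqxx; apply/eqP.
  have ends_diff a b : a < n -> b < n -> a < b -> ed' a <> ed' b.
    move=> an bn ab Eab; have [bn1|bn1] := eqVneq b n.-1.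
      have [a0|a0] := eqVneq a 0; first by rewrite a0 bn1 in Eab.
      have /negP := in_e a ltac:(nat_lia); apply; by rewrite Eab bn1.
    have [a0|a0] := eqVneq a 0.
      have /negP := in_e b ltac:(nat_lia); apply; by rewrite -Eab a0.
    have Ew : [set w a; w a.+1] = [set w b; w b.+1].
      by have [_ <-] := edE a an; have [_ <-] := edE b bn; rewrite Eab.
    have := set21 (w a) (w a.+1); rewrite Ew => /set2P[] /w_inj; nat_lia.
  move=> a b an bn Eab; case: (ltngtP a b) => // ab.
    by case: (ends_diff a b).
  by case: (ends_diff b a).
- by move=> k _; rewrite wn; apply: robust_refl.
Qed.

Lemma walk_nth (H : graph T E) x p k e0 : walk ends H x p -> k < size p ->
  nth e0 (unzip1 p) k \in edges H /\
  ends (nth e0 (unzip1 p) k) = [set nth x (x :: unzip2 p) k; nth x (x :: unzip2 p) k.+1].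
Proof.
(* The default of [nth] stays fixed while the start of the walk moves. *)
move: {2 4}x => d; elim: p x k => [//|[f y] p IH] x k /= /and3P[fH /eqP fxy wp].
by case: k => [_|k kp] /=; [rewrite fH fxy | have := IH y k wp kp].
Qed.

(** A cycle inside [C] is a closed chord. At a node outside [C] both cycle edges lead into [C], so
    they coincide by [neighbor_edge_uniq], which leaves only a loop. *)
Lemma Rcomponent_acyclic x p : ~~ is_cycle ends K x p.
Proof.
apply/negP=> /and5P[p0 wp /eqP lp u1 u2].
have [e0] : exists e0 : E, True by case: p p0 {wp lp u1 u2} => // -[f y]; exists f.
move=> _; pose w := nth x (x :: unzip2 p); pose ed := nth e0 (unzip1 p).
pose n := size p; have n_gt0 : 0 < n by rewrite lt0n size_eq0.
have wn : w n = w 0 by rewrite /w /= -[RHS]lp (last_nth x) size_map.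
have edP k : k < n -> [/\ ed k \in edges K, ed k \in edges G
    & ends (ed k) = [set w k; w k.+1]].
  move=> kn; have [eK eE] := walk_nth e0 wp kn; split=> //.
  by have [] := Rcomponent_edge eK eE.
have w_inj a b : 0 < a <= n -> 0 < b <= n -> w a = w b -> a = b.
  case: a b => [//|a] [//|b] /= an bn; rewrite /w /= => /eqP.
  by rewrite nth_uniq ?size_map // => /eqP->.
have ed_inj a b : a < n -> b < n -> ed a = ed b -> a = b.
  by move=> an bn /eqP; rewrite nth_uniq ?size_map // => /eqP.
have [allC|] := boolP [forall k : 'I_n, w k \in C].
  have wC k : k < n -> w k \in C by move=> kn; apply: (forallP allC (Ordinal kn)).
  apply: (@no_chord T E ends G R Q r wfG RV r_sym r_012 minG w ed n) => //.
  - by move=> k /edP[].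
  - by move=> k /edP[].
  - by move=> k /andP[_ /wC kC]; rewrite in_setD (component_notR kC) (component_Q kC).
  - by move=> k kn; rewrite -wn; apply/eqP=> /w_inj; nat_lia.
  - by move=> k _; rewrite wn; apply: robust_refl.
rewrite negb_forall => /existsP[k kC].
(* The index, taken cyclically, of the edge that enters [w k]. *)
pose k' := if val k == 0 then n.-1 else k.-1.
have k'n : k' < n by rewrite /k'; have := ltn_ord k; case: ifP; nat_lia.
have wk' : w k'.+1 = w k.
  rewrite /k'; have [k0|k0] := eqVneq (val k) 0; last by rewrite prednK // lt0n.
  by rewrite prednK // wn -k0.
have [eK eG eE] := edP k (ltn_ord k); have [fK fG fE] := edP k' k'n.
have [_ [kC'|dC]] := Rcomponent_edge eK eE; first by rewrite kC' in kC.
have [_ [cC|kC']] := Rcomponent_edge fK fE; last by rewrite -wk' kC' in kC.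
rewrite wk' in fE.
have /(ed_inj _ _ (ltn_ord k) k'n) Ek := neighbor_edge_uniq kC dC cC eG fG eE fE.
by have := wf_neq wfG eG eE; rewrite -wk' -Ek eqxx.
Qed.

Lemma Rcomponent_tree : is_tree ends K.
Proof. by split; [apply: Rcomponent_connected | apply: Rcomponent_acyclic]. Qed.

End OneComponent.

End Components.

(** * Replacing components by cycles *)

Lemma dfs_uniq (T : finType) (g : T -> seq T) n v x :
  uniq v -> uniq (dfs g n v x).
Proof.
elim: n v x => [|n IHn] v x uv /=; first by case: ifP.
case: ifPn => // xv; have : uniq (x :: v) by rewrite /= xv.
by elim: (g x) (x :: v) => //= y a IHa v' uv'; apply/IHa/IHn.
Qed.

Lemma next_leaves (T : finType) (s : seq T) (P : pred T) a b :
  uniq s -> a \in s -> b \in s -> P a -> ~~ P b ->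
  exists x, [/\ x \in s, P x & ~~ P (next s x)].
Proof.
move=> us as_ bs Pa nPb.
have : fconnect (next s) a b by rewrite (fconnect_cycle (cycle_next us)).
case/connectP=> p pp lb; rewrite {b bs}lb in nPb.
elim: p a as_ Pa pp nPb => [|y p IH] a as_ Pa /=; first by rewrite Pa.
case/andP=> /eqP<- pp nPb; have [Py|nPy] := boolP (P (next s a)).
  by apply: (IH (next s a)); rewrite ?mem_next.
by exists a.
Qed.

(** * Capacity across a biset *)

Section Fractional.

Variables (T E : finType) (ends : E -> {set T}) (G : graph T E).
Variables (R Q : {set T}) (r : T -> T -> nat).
Hypotheses (wfG : well_formed ends G) (RV : R \subset nodes G).
Hypothesis QRV : Q :|: R = nodes G.
Hypothesis r_sym : forall u v, u \in R -> v \in R -> r u v = r v u.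
Hypothesis r_012 : forall u v, u \in R -> v \in R -> r u v \in [:: 0; 1; 2].
Hypothesis minG : minimally_rQ_connected ends r R Q G.

Variables (CC : {set {set T}}) (s : {set T} -> seq T).
Hypothesis CC_components : CC \subset components ends (graphD ends G R).
Hypothesis s_uniq : forall C, C \in CC -> uniq (s C).
Hypothesis s_mem : forall C, C \in CC -> s C =i neighbors ends G C.

Variables Y Yp : {set T}.
Hypotheses (YYp : Y \subset Yp) (YpV : Yp \subset nodes G :\: cover CC).

Local Notation V' := (nodes G :\: cover CC).
Local Notation L C := (neighbors ends G C).
Local Notation rG := (repl_graph ends G CC).
Local Notation covered := [set e : repl_edge T E in edges rG
                          | covers V' Y Yp (repl_ends ends s e)].

Lemma CC_component C : C \in CC -> C \in components ends (graphD ends G R).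
Proof. exact: (subsetP CC_components). Qed.

Lemma R_outside_CC x : x \in R -> x \notin cover CC.
Proof.
move=> xR; apply/negP=> /bigcupP[C /CC_component Cc xC].
by have := component_notR Cc xC; rewrite xR.
Qed.

Lemma coversP S : reflect (exists x y, [/\ x \in Y, y \in V' :\: Yp & S = [set x; y]])
  (covers V' Y Yp S).
Proof.
apply: (iffP existsP) => [[x /andP[xY /existsP[y /andP[yV /eqP->]]]]|[x [y [xY yV ->]]]].
  by exists x, y.
by exists x; rewrite xY; apply/existsP; exists y; rewrite yV eqxx.
Qed.

(* The replaced graph is split into objects: single edges of G, and cycles. *)
Definition object (e : repl_edge T E) : E + {set T} :=
  match e with inl e0 => inl e0 | inr (C, _) => inr C end.

Local Open Scope ring_scope.

Definition weight (o : E + {set T}) : rat :=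
  \sum_(e in covered | object e == o) repl_cap e.

Lemma repl_cap_ge0 (e : repl_edge T E) : 0 <= repl_cap e.
Proof. by case: e. Qed.

Lemma weight_ge0 o : 0 <= weight o.
Proof. by apply: sumr_ge0 => e _; apply: repl_cap_ge0. Qed.

Lemma capacity_weight : \sum_(e in covered) repl_cap e = \sum_o weight o.
Proof. by rewrite (partition_big object predT). Qed.

Lemma capacity_ge_weight o : weight o <= \sum_(e in covered) repl_cap e.
Proof.
rewrite capacity_weight (bigD1 o) //= lerDl.
by apply: sumr_ge0 => o' _; apply: weight_ge0.
Qed.

Lemma capacity_ge_weight2 o1 o2 : o1 != o2 ->
  weight o1 + weight o2 <= \sum_(e in covered) repl_cap e.
Proof.
move=> no; rewrite capacity_weight (bigD1 o1) //= (bigD1 o2) 1?eq_sym //= addrA lerDl.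
by apply: sumr_ge0 => o' _; apply: weight_ge0.
Qed.

Lemma weight_ge_cap e : e \in covered -> repl_cap e <= weight (object e).
Proof.
move=> ec; rewrite /weight (bigD1 e) /= ?ec ?eqxx // lerDl.
by apply: sumr_ge0 => f _; apply: repl_cap_ge0.
Qed.

Lemma weight_ge_cap2 e f : e \in covered -> f \in covered -> e != f ->
  object e = object f -> repl_cap e + repl_cap f <= weight (object e).
Proof.
move=> ec fc nef oef; rewrite /weight (bigD1 e) /= ?ec ?eqxx //.
rewrite (bigD1 f) /= ?fc ?oef ?eqxx 1?eq_sym // addrA lerDl.
by apply: sumr_ge0 => g _; apply: repl_cap_ge0.
Qed.

(** A cycle counts as crossing once it has nodes on both sides, even if none of its edges has been
    shown to cover the biset; this is independent of the order [s C]. *)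
Definition crosses (o : E + {set T}) : Prop :=
  match o with
  | inl e => inl e \in covered
  | inr C => [/\ C \in CC, exists2 a, a \in L C & a \in Y
               & exists2 b, b \in L C & b \in V' :\: Yp]
  end.

Lemma neighbors_V' C x : C \in CC -> x \in L C -> x \in V'.
Proof.
move=> /CC_component Cc xL; have xR := neighbors_R wfG Cc xL.
by rewrite inE (subsetP RV) // R_outside_CC.
Qed.

Lemma notin_Yp x : x \in V' :\: Yp -> x \notin Yp.
Proof. by rewrite inE => /andP[]. Qed.

Lemma cycle_edge_covered C x : C \in CC -> x \in L C ->
  covers V' Y Yp [set x; next (s C) x] -> inr (C, x) \in covered.
Proof. by move=> CCC xL cov; rewrite inE; apply/andP; split=> //; rewrite inE CCC. Qed.

(** The cycle leaves [Y] and enters it again, which takes two edges of capacity 1/2. Even if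
    parallel they are distinct, being indexed by different tails. *)
Lemma weight_cycle C : crosses (inr C) ->
  [disjoint L C & Yp :\: Y] -> 1 <= weight (inr C).
Proof.
case=> CCC [a aL aY] [b bL bV] dis.
have inY x : x \in L C -> x \notin Y -> x \in V' :\: Yp.
  move=> xL xY; rewrite in_setD (neighbors_V' CCC xL) andbT.
  apply/negP=> xYp; have := disjointFr dis xL; by rewrite in_setD xY xYp.
have bY : b \notin Y by apply: contra (notin_Yp bV); apply: (subsetP YYp).
have sa : a \in s C by rewrite s_mem.
have sb : b \in s C by rewrite s_mem.
have [x [xs xY nxY]] := @next_leaves _ _ (mem Y) _ _ (s_uniq CCC) sa sb aY bY.
have naY : ~~ (a \notin Y) by rewrite negbK.
have [y [ys yY]] := @next_leaves _ _ (fun x => x \notin Y) _ _ (s_uniq CCC) sb sa bY naY.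
rewrite negbK => nyY.
have xL : x \in L C by rewrite -s_mem.
have yL : y \in L C by rewrite -s_mem.
have nxL : next (s C) x \in L C by rewrite -s_mem // mem_next.
have nxy : (inr (C, x) : repl_edge T E) != inr (C, y).
  by apply: contraNneq yY => -[<-].
have := @weight_ge_cap2 (inr (C, x)) (inr (C, y)) _ _ nxy erefl.
rewrite /= => le1; apply: le_trans (le1 _ _) => //.
- apply: cycle_edge_covered => //; apply/coversP; exists x, (next (s C) x).
  by rewrite inY.
- apply: cycle_edge_covered => //; apply/coversP; exists (next (s C) y), y.
  by rewrite inY // setUC.
Qed.

(** One edge leaves [Y] at [x], and one leaves the outside at [y]. If neither covers the biset, both
    lead to [z], so [x = y] by injectivity of [next], which is absurd. *)
Lemma weight_cycle_half C z : crosses (inr C) -> Yp :\: Y = [set z] ->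
  1 / 2%:R <= weight (inr C).
Proof.
case=> CCC [a aL aY] [b bL bV] Ez.
have side x : x \in L C -> x \notin Y -> x != z -> x \in V' :\: Yp.
  move=> xL xY xz; rewrite in_setD (neighbors_V' CCC xL) andbT.
  apply/negP=> xYp; have : x \in [set z] by rewrite -Ez in_setD xY.
  by rewrite inE (negPf xz).
have Y_notV x : x \in Y -> x \notin V' :\: Yp.
  by move=> xY; rewrite in_setD negb_and negbK (subsetP YYp).
have zV : z \notin V' :\: Yp.
  by have : z \in Yp :\: Y by [rewrite Ez set11]; rewrite !in_setD => /andP[_ ->].
have sa : a \in s C by rewrite s_mem.
have sb : b \in s C by rewrite s_mem.
have bY : b \notin Y by apply: contraTN bV; apply: Y_notV.
have [x [xs xY nxY]] := @next_leaves _ _ (mem Y) _ _ (s_uniq CCC) sa sb aY bY.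
have [y [ys yV nyV]] :=
  @next_leaves _ _ (mem (V' :\: Yp)) _ _ (s_uniq CCC) sb sa bV (Y_notV a aY).
have xL : x \in L C by rewrite -s_mem.
have yL : y \in L C by rewrite -s_mem.
have nxL : next (s C) x \in L C by rewrite -s_mem // mem_next.
have nyL : next (s C) y \in L C by rewrite -s_mem // mem_next.
have [Ex|nxz] := eqVneq (next (s C) x) z; last first.
  apply: (@weight_ge_cap (inr (C, x))); apply: cycle_edge_covered => //.
  by apply/coversP; exists x, (next (s C) x); rewrite side.
have [Ey|nyz] := eqVneq (next (s C) y) z.
  have Exy : x = y by apply: (can_inj (prev_next (s_uniq CCC))); rewrite Ex Ey.
  by case/negP: (Y_notV x xY); rewrite Exy.
apply: (@weight_ge_cap (inr (C, y))); apply: cycle_edge_covered => //.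
apply/coversP; exists (next (s C) y), y; rewrite setUC; split=> //.
by apply: contraR nyV => nyY; apply: side.
Qed.

Definition seen_by (p : seq (E * T)) (o : E + {set T}) : Prop :=
  match o with
  | inl e => e \in unzip1 p
  | inr C => exists2 c, c \in C & c \in unzip2 p
  end.

Lemma node_cases x : x \in nodes G -> x \notin Yp :\: Y ->
  [\/ x \in Y, x \in V' :\: Yp | exists2 C, C \in CC & x \in C].
Proof.
move=> xG xYY; have [/bigcupP[C CCC xC]|xC] := boolP (x \in cover CC).
  by constructor 3; exists C.
have [xY|xY] := boolP (x \in Y); first by constructor 1.
constructor 2; rewrite !in_setD xG xC !andbT.
by move: xYY; rewrite in_setD xY.
Qed.

Lemma component_disjoint C x : C \in CC -> x \in C -> x \notin V'.
Proof.
by move=> CCC xC; rewrite in_setD negb_and negbK; apply/orP; left; apply/bigcupP; exists C.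
Qed.

Lemma neighborI C c y : C \in CC -> c \in C -> y \in V' -> adj ends G c y ->
  y \in L C.
Proof.
move=> CCC cC yV cy; rewrite !inE; apply/andP; split.
  apply/andP; split; first by apply: contraTN yV; apply: component_disjoint.
  by move: yV; rewrite inE => /andP[].
by apply/existsP; exists c; rewrite cC.
Qed.

(** The invariant along the walk is that the current node is in [Y] or in a replaced component with
    a neighbor in [Y]; the step to the far side then exhibits a crossing edge or component. The last
    disjunct is there because [seen_by] ignores the start [x]. *)
Lemma walk_crosses x p : walk ends G x p -> last x (unzip2 p) \in V' :\: Yp ->
  {in unzip2 p, forall y, y \notin Yp :\: Y} ->
  x \in Y \/ (exists C, [/\ C \in CC, x \in C & exists2 a, a \in L C & a \in Y]) ->
  exists2 o, crosses o & seen_by p o \/ exists2 C, o = inr C & x \in C.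
Proof.
have Y_V' z : z \in Y -> z \in V' by move/(subsetP YYp)/(subsetP YpV).
elim: p x => [|[e y] p IH] x /=.
  move=> _ xV _ [xY|[C [CCC xC _]]].
    by have := notin_Yp xV; rewrite (subsetP YYp).
  by case/setDP: xV => xV; rewrite (negPf (component_disjoint CCC xC)) in xV.
case/and3P=> eG /eqP exy wp lV pYY inv.
have xy : adj ends G x y by apply/adjP; exists e.
have yG : y \in nodes G by apply: (wf_nodes wfG eG); rewrite exy set22.
have pYY' : {in unzip2 p, forall z, z \notin Yp :\: Y}.
  by move=> z zp; apply: pYY; rewrite inE zp orbT.
have {}IH := IH y wp lV pYY'.
have next_ok : y \in Y \/ (exists C, [/\ C \in CC, y \in C
    & exists2 a, a \in L C & a \in Y]) ->
    exists2 o, crosses o & seen_by ((e, y) :: p) o \/ exists2 C, o = inr C & x \in C.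
  move=> /IH[o co so]; exists o => //; left; case: so => [|[C -> yC]]; last first.
    by exists y; rewrite //= mem_head.
  case: (o) => [f|C] /= => [fp|[c cC cp]]; first by rewrite inE fp orbT.
  by exists c; rewrite // inE cp orbT.
have [yY|yV|[C CCC yC]] := node_cases yG (pYY y (mem_head _ _)).
- by apply: next_ok; left.
- case: inv => [xY|[C [CCC xC aL]]].
    exists (inl e); last by left; rewrite /= mem_head.
    rewrite /= inE; apply/andP; split; last by apply/coversP; exists x, y.
    (* An edge between two surviving nodes belongs to no replaced R-component. *)
    rewrite inE eG; apply/forallP=> C; apply/implyP=> CCC; apply/negP=> eC.
    have [_ [xC|yC]] := Rcomponent_edge wfG eC exy.
      by have := component_disjoint CCC xC; rewrite Y_V'.
    by have := component_disjoint CCC yC; case/setDP: yV => ->.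
  exists (inr C); last by right; exists C.
  split=> //; exists y => //; case/setDP: yV => yV _.
  exact: (neighborI CCC xC yV xy).
- apply: next_ok; right; case: inv => [xY|[C' [CCC' xC' aL]]].
    exists C; split=> //; exists x => //.
    by apply: (neighborI CCC yC); rewrite ?Y_V' // adj_sym.
  exists C'; split=> //; apply: (component_step wfG (CC_component CCC') xC' xy).
  exact: (component_notR (CC_component CCC) yC).
Qed.

Lemma path_crosses u v p : is_uvpath ends G u v p -> u \in Y -> v \in V' :\: Yp ->
  {in unzip2 p, forall y, y \notin Yp :\: Y} ->
  exists2 o, crosses o & seen_by p o.
Proof.
case/and3P=> wp /eqP lp _ uY vV pYY.
rewrite -lp in vV; have [o co [so|[C Eo uC]]] := walk_crosses wp vV pYY (or_introl uY).
  by exists o.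
move: co; rewrite Eo => -[CCC _ _].
have := component_disjoint CCC uC.
by rewrite (subsetP YpV) // (subsetP YYp).
Qed.

Lemma weight_ge1 o : crosses o -> Yp :\: Y = set0 -> 1 <= weight o.
Proof.
case: o => [e eC _|C co E0]; first exact: (weight_ge_cap eC).
by apply: weight_cycle; rewrite // E0 disjoint_sym -setI_eq0 set0I.
Qed.

Lemma weight_ge_half o z : crosses o -> Yp :\: Y = [set z] -> 1 / 2%:R <= weight o.
Proof.
case: o => [e eC _|C co E0]; last exact: weight_cycle_half E0.
exact: le_trans (weight_ge_cap eC).
Qed.

(** If both paths met the same [C], a path inside [C] between them would be a chord. *)
Lemma objects_differ u v P1 P2 o1 o2 : u \in R -> v \in R ->
  is_uvpath ends G u v P1 -> is_uvpath ends G u v P2 -> Qdisjoint Q u v P1 P2 ->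
  crosses o1 -> seen_by P1 o1 -> seen_by P2 o2 -> o1 != o2.
Proof.
move=> uR vR P1p P2p dis co1 s1 s2; apply/eqP=> Eo; rewrite -{o2}Eo in s2.
case: o1 co1 s1 s2 => [e _|C [/CC_component Cc _ _]] /=.
  by case/andP: dis => /hasPn dE _ e1 /dE /=; rewrite e1.
move=> [c1 c1C c1P] [c2 c2C c2P]; have [p [pp lp up pC]] := component_path wfG Cc c2C c1C.
have notuv := component_off_terminals QRV Cc uR vR.
apply: (no_theta_path wfG RV r_sym r_012 minG P1p P2p dis pp up) => //.
- by move=> y /pC; apply: notuv.
- by move=> y yp; apply: (component_notR Cc); apply: pC; rewrite inE yp orbT.
- by rewrite lp.
Qed.

(* If z were in Gamma(C), a path from z through C would be a chord of the cycle
   formed by the two paths. *)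
Lemma avoiding_path_weight u v P1 P2 o z : u \in R -> v \in R ->
  is_uvpath ends G u v P1 -> is_uvpath ends G u v P2 -> Qdisjoint Q u v P1 P2 ->
  Yp :\: Y = [set z] -> z \in Q :\: [set u; v] -> z \in unzip2 P2 ->
  crosses o -> seen_by P1 o -> 1 <= weight o.
Proof.
move=> uR vR P1p P2p dis Ez zQ z2; case: o => [e eC _|C co so].
  exact: (weight_ge_cap eC).
apply: weight_cycle => //; rewrite Ez disjoint_sym disjoints1; apply/negP=> zL.
case: co so => /CC_component Cc _ _ [c1 c1C c1P].
have zR := neighbors_R wfG Cc zL.
move: zL; rewrite inE => /andP[_ /existsP[c /andP[cC cz]]].
have [p [pp lp up pC]] := component_path wfG Cc cC c1C.
have notuv := component_off_terminals QRV Cc uR vR.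
apply: (@no_theta_path _ _ ends G R Q r wfG RV r_sym r_012 minG u v P1 P2 z (c :: p)) => //.
- by rewrite /= adj_sym cz.
- rewrite cons_uniq up andbT; apply: contraL zR => /pC.
  exact: (component_notR Cc).
- by move=> y; rewrite inE => /predU1P[->|/pC/notuv].
- by move=> y /pC; exact: (component_notR Cc).
- by rewrite /= lp.
Qed.

Lemma cut_pair_capacity u v : u \in R -> v \in R -> u \in Y -> v \in V' :\: Yp ->
  Yp :\: Y \subset Q ->
  (r u v)%:R - #|Yp :\: Y|%:R <= \sum_(e in covered) repl_cap e.
Proof.
move=> uR vR uY vV GQ.
have cap_ge0 : 0 <= \sum_(e in covered) repl_cap e.
  by apply: sumr_ge0 => e _; apply: repl_cap_ge0.
have [r_le|r_gt] := leqP (r u v) #|Yp :\: Y|.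
  by apply: le_trans cap_ge0; rewrite subr_le0 ler_nat.
have nuv : u != v.
  by apply: contraTneq uY => ->; apply: contra (notin_Yp vV); apply: (subsetP YYp).
have uYY : u \notin Yp :\: Y by rewrite in_setD uY.
have vYY : v \notin Yp :\: Y by rewrite in_setD negb_and (notin_Yp vV) orbT.
have lamG := minG.1 u v uR vR nuv (leq_ltn_trans (leq0n _) r_gt).
have r_le2 : (r u v <= 2)%N by have := r_012 uR vR; rewrite !inE; lia.
(* With Gamma(Y) empty, as many disjoint paths as demanded cross at distinct objects of weight at
   least 1. *)
have [G0|G0] := posnP #|Yp :\: Y|.
  have E0 : Yp :\: Y = set0 by apply/eqP; rewrite -cards_eq0 G0.
  have noYY (p : seq (E * T)) : {in unzip2 p, forall y, y \notin Yp :\: Y}.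
    by move=> y _; rewrite E0 inE.
  rewrite G0 subr0; have [r1|r2] := leqP (r u v) 1.
    have [p pP] := Qlambda_path (leq_trans (leq_ltn_trans (leq0n _) r_gt) lamG).
    have [o co _] := path_crosses pP uY vV (noYY p).
    apply: le_trans (capacity_ge_weight o); apply: le_trans (weight_ge1 co E0).
    by rewrite (ler_nat _ _ 1).
  have [P1 [P2 [P1p P2p dis]]] := Qlambda_paths (leq_trans r2 lamG).
  have [o1 co1 so1] := path_crosses P1p uY vV (noYY P1).
  have [o2 co2 so2] := path_crosses P2p uY vV (noYY P2).
  have no := objects_differ uR vR P1p P2p dis co1 so1 so2.
  apply: le_trans (capacity_ge_weight2 no).
  apply: le_trans (lerD (weight_ge1 co1 E0) (weight_ge1 co2 E0)).
  by rewrite (ler_nat _ _ 2).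
(* What remains is a demand of 2 with one node [z], so capacity 1 is needed. If one path passes
   through [z], the other path provides it; else each path provides one half. *)
have [G1 r2] : #|Yp :\: Y| = 1%N /\ r u v = 2 by lia.
have /cards1P[z Ez] : #|Yp :\: Y| == 1%N by rewrite G1.
rewrite G1 r2 (_ : 2%:R - 1%:R = 1) //.
have zQ : z \in Q :\: [set u; v].
  have zG : z \in Yp :\: Y by rewrite Ez set11.
  rewrite in_setD (subsetP GQ) // andbT !inE negb_or.
  by apply/andP; split; apply: contraTneq zG => ->.
have avoid (p : seq (E * T)) : z \notin unzip2 p -> {in unzip2 p, forall y, y \notin Yp :\: Y}.
  by move=> zp y yp; rewrite Ez inE; apply: contraNneq zp => <-.
have r_gt1 : (1 < r u v)%N by rewrite r2.
have [P1 [P2 [P1p P2p dis]]] := Qlambda_paths (leq_trans r_gt1 lamG).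
have [z1|z1] := boolP (z \in unzip2 P1).
  have z2 : z \notin unzip2 P2.
    apply/negP=> z2; case/andP: dis => _ /hasPn/(_ z z2)/negP; apply.
    by apply/andP.
  have [o co so] := path_crosses P2p uY vV (avoid _ z2).
  apply: le_trans (capacity_ge_weight o).
  by apply: (avoiding_path_weight uR vR P2p P1p _ Ez zQ z1 co so); rewrite Qdisjoint_sym.
have [o1 co1 so1] := path_crosses P1p uY vV (avoid _ z1).
have [z2|z2] := boolP (z \in unzip2 P2).
  apply: le_trans (capacity_ge_weight o1).
  exact: (avoiding_path_weight uR vR P1p P2p dis Ez zQ z2 co1 so1).
have [o2 co2 so2] := path_crosses P2p uY vV (avoid _ z2).
have no := objects_differ uR vR P1p P2p dis co1 so1 so2.
apply: le_trans (capacity_ge_weight2 no).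
exact: le_trans (lerD (weight_ge_half co1 Ez) (weight_ge_half co2 Ez)).
Qed.

Lemma biset_capacity : biset_req r R Q V' Y Yp <= \sum_(e in covered) repl_cap e.
Proof.
have cap_ge0 : 0 <= \sum_(e in covered) repl_cap e.
  by apply: sumr_ge0 => e _; apply: repl_cap_ge0.
rewrite /biset_req; case: ifP => // GQ.
have [->|m_gt0] := posnP (biset_max r R V' Y Yp).
  by apply: le_trans cap_ge0; rewrite sub0r oppr_le0 ler0n.
(* Exceeding the predecessor of the maximum means attaining the maximum. *)
have [|[u v] /= /and4P[uR vR /coversP[x [y [xY yV Exy]]] _]] :=
  @bigmax_witness _ _ _ (biset_max r R V' Y Yp).-1 (_ : (_ < biset_max r R V' Y Yp)%N).
  by rewrite prednK.
rewrite prednK // => le_r.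
(* Covering concerns the unordered pair, so the maximizing pair may be the reverse of [x], [y]. *)
have [xR yR Er] : [/\ x \in R, y \in R & r u v = r x y].
  have nxy : x != y.
    by apply: contraTneq xY => ->; apply: contra (notin_Yp yV); apply: (subsetP YYp).
  have := set21 x y; have := set22 x y; rewrite -Exy.
  by move=> /set2P[] Ey /set2P[] Ex; rewrite Ex Ey ?eqxx // in nxy *; split; rewrite // r_sym.
apply: le_trans (cut_pair_capacity xR yR xY yV GQ).
by rewrite lerD2r ler_nat -Er.
Qed.

End Fractional.

Lemma dfs_cycle_uniq (T E : finType) (ends : E -> {set T}) (K : graph T E)
    (L : {set T}) s : dfs_cycle ends K L s -> uniq s.
Proof. by case=> g [root [_ _ ->]]; rewrite filter_uniq // rev_uniq dfs_uniq. Qed.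

Lemma dfs_cycle_mem (T E : finType) (ends : E -> {set T}) (K : graph T E)
    (L : {set T}) s : connected ends K -> L \subset nodes K ->
  dfs_cycle ends K L s -> s =i L.
Proof.
move=> [_ conK] /subsetP LK [g [root [gE rootK ->]]] x.
rewrite mem_filter mem_rev; have [xL|//] := boolP (x \in L).
have /connectP[p pp lp] := conK _ _ rootK (LK _ xL).
apply/dfsP; exists p => //; rewrite -(eq_path (e := adj ends K)) // => a b.
by rewrite /= gE.
Qed.

Theorem theorem5 (T E : finType) (ends : E -> {set T}) (G : graph T E)
    (R Q : {set T}) (r : T -> T -> nat)
    (wfG : well_formed ends G)
    (RV : R \subset nodes G) (QV : Q \subset nodes G)
    (QRV : Q :|: R = nodes G)
    (r_sym : forall u v, u \in R -> v \in R -> r u v = r v u)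
    (r_012 : forall u v, u \in R -> v \in R -> r u v \in [:: 0; 1; 2])
    (minG : minimally_rQ_connected ends r R Q G) :
  (forall C, C \in components ends (graphD ends G R) ->
     is_tree ends (Rcomponent ends G C)) /\
  (forall (CC : {set {set T}}) (s : {set T} -> seq T),
     CC \subset components ends (graphD ends G R) ->
     (forall C, C \in CC ->
        dfs_cycle ends (Rcomponent ends G C) (neighbors ends G C) (s C)) ->
     frac_rQ_connected (repl_ends ends s) (@repl_cap T E) r R Q
       (repl_graph ends G CC)).
Proof.
have tree C := @Rcomponent_tree T E ends G R Q r wfG RV QRV r_sym r_012 minG C.
split=> // CC s sCC dfs_s; split=> [[e|[C x]] _ //|Y Yp YYp YpV].
(* The DFS order enters through two facts: it repeats no node, and it lists exactly the nodes of
   Gamma(C). *)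
have s_uniq C : C \in CC -> uniq (s C) by move=> /dfs_s/dfs_cycle_uniq.
have s_mem C : C \in CC -> s C =i neighbors ends G C.
  move=> CCC; apply: dfs_cycle_mem (dfs_s C CCC); last exact: subsetUr.
  by have [] := tree C (subsetP sCC C CCC).
apply: le_trans (biset_capacity wfG RV QRV r_sym r_012 minG sCC s_uniq s_mem YYp YpV) _.
by rewrite le_eqVlt; apply/orP; left; apply/eqP; apply: eq_bigl => e; rewrite inE.
Qed.
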